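(* Let $\mathbf{s}$ be a sequence of pairs of positive integers with $n(\mathbf{s})=4$. Then $$\lim_{q\to\infty}\theta(\mathbf{s},q)=1.$$
   Context: Throughout, $q$ ranges over prime powers and $k=\mathbb{F}_q$ is the finite field with $q$ elements. For a (finite, nonempty) sequence $\mathbf{s}=\{(e_1,f_1),\ldots,(e_t,f_t)\}$ of pairs of positive integers (repetitions allowed), put $n(\mathbf{s}):=\sum_i e_if_i$ and, for each $q$, let $B_{\mathbf{s}}:=\prod_{i=1}^t\mathbb{F}_{q^{e_i}}[X]/(X^{f_i})$, regarded as a $k$-algebra via the diagonal embedding of $k$; $n(\mathbf{s})=\dim_k B_{\mathbf{s}}$. For a finite $k$-algebra $B$, let $\mathcal{F}_0(k,B)$ be the set of $k$-subspaces $I$ of $B$ with $IB=B$. For a subset $I\subseteq B$ and $b\in B$ let $(I:b):=\{x\in B\mid bx\in I\}$. A closure operation on a partially ordered set is an extensive, order-preserving, idempotent self-map. A multiplicative operation on $(k,B,\mathcal{F}_0(k,B))$ is a closure operation $I\mapsto I^\star$ on $\mathcal{F}_0(k,B)$ (ordered by inclusion) such that $(I:b)^\star\subseteq(I^\star:b)$ for all $I\in\mathcal{F}_0(k,B)$ and all $b\in B$ with $(I:b)\in\mathcal{F}_0(k,B)$. A star operation on $(k,B)$ is a multiplicative operation $\star$ on $(k,B,\mathcal{F}_0(k,B))$ with $k^\star=k$; $\mathrm{Star}(k,B)$ is the set of all of them. Set $\Lambda(\mathbf{s},q):=|\mathrm{Star}(k,B_{\mathbf{s}})|$ and $\theta(\mathbf{s},q):=\log_q\log_2\Lambda(\mathbf{s},q)$.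 *)

(* Defs.v *)
From HB Require Import structures.
From mathcomp Require Import all_boot all_order all_algebra all_field.
From mathcomp Require Import mathcomp_extra boolp classical_sets functions.
From mathcomp Require Import reals topology normedtype sequences exp.

Set Implicit Arguments.
Unset Strict Implicit.
Unset Printing Implicit Defensive.

Import Order.TTheory GRing.Theory Num.Theory.
Import numFieldNormedType.Exports.
Import VectorInternalTheory.

Local Open Scope ring_scope.

Definition prime_power (q : nat) : Prop :=
  exists p m : nat, [/\ prime p, (0 < m)%N & q = (p ^ m)%N].

Lemma GF_exists (q : nat) : {k : finFieldType | prime_power q -> #|k| = q}.
Proof.
have [/andP[q_gt1 /eqP qE]|nq] :=
  boolP ((1 < q)%N && (q == pdiv q ^ logn (pdiv q) q)%N).
  have m_gt0 : (0 < logn (pdiv q) q)%N.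
    by rewrite logn_gt0 mem_primes pdiv_prime // pdiv_dvd (ltnW q_gt1).
  have [k _ kE] := pPrimePowerField (pdiv_prime q_gt1) m_gt0.
  by exists k => _; rewrite kE -qE.
exists 'F_2 => -[p [m [p_pr m_gt0 qE]]]; case/negP: nq.
rewrite qE -{1}(expn0 p) ltn_exp2l ?prime_gt1 // m_gt0 /=.
by rewrite -(prednK m_gt0) pdiv_pfactor // pfactorK.
Qed.

Definition GF (q : nat) : finFieldType := sval (GF_exists q).

Lemma GFext_exists (k : finFieldType) (e : nat) :
  {L : fieldExtType k | (0 < e)%N -> \dim {:L} = e}.
Proof.
have [->|e_gt0] := posnP e; first by exists k^o.
set n := #|k|; have n_gt1 : (1 < n)%N := finNzRing_gt1 k.
set m := (n ^ e)%N; have m_gt1 : (1 < m)%N by rewrite (ltn_exp2l 0).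
have m_gt0 := ltnW m_gt1; have m1_gt0 : (0 < m.-1)%N by rewrite -ltnS prednK.
pose q (R : nzRingType) : {poly R} := 'X^m - 'X.
have Dq R : q R = ('X^(m.-1) - 1) * ('X - 0).
  by rewrite subr0 mulrBl mul1r -exprSr prednK.
have /FinSplittingFieldFor[/= L splitLq] : q k != 0.
  by rewrite Dq monic_neq0 ?rpredM ?monicXsubC ?monicXnsubC.
rewrite [map_poly _ _]rmorphB rmorphXn /= map_polyX -/(q L) in splitLq.
exists L => _.
have [p p_pr pchark] := finPcharP k.
have pcharL : p \in [pchar L] by rewrite pchar_lalg.
have p_dvd_n : (p %| n)%N.
  by rewrite /n (card_pprimeChar pchark) dvdn_exp //;
     rewrite -(ltn_exp2l _ _ (prime_gt1 p_pr)) -card_pprimeChar.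
have m0 : m%:R = 0 :> L.
  by apply/eqP; rewrite -(dvdn_pcharf pcharL) dvdn_exp.
pose Fm := FinFieldExtType L.
have /finField_galois_generator[/= a _ Da] : (1 <= {:L})%VS by apply: sub1v.
pose Em := fixedSpace (a ^+ e)%g; rewrite dimv1 expn1 -/n in Da.
have{splitLq} [zs DqL defL] := splitLq.
have Uzs : uniq zs.
  rewrite -separable_prod_XsubC -(eqp_separable DqL) Dq separable_root andbC.
  rewrite /root !hornerE subr_eq0 eq_sym expr0n gtn_eqF ?oner_eq0 //=.
  rewrite cyclotomic.separable_Xn_sub_1 // -subn1 natrB // subr_eq0.
  by rewrite m0 eq_sym oner_eq0.
have in_zs : zs =i Em.
  move=> z; rewrite -root_prod_XsubC -(eqp_root DqL) (sameP fixedSpaceP eqP).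
  rewrite /root !hornerE subr_eq0 /= /m; congr (_ == z).
  elim: (e) => [|i IHi]; first by rewrite gal_id.
  by rewrite expgSr expnSr exprM IHi galM ?Da ?memvf.
have defEm : Em = {:L}%VS.
  apply/eqP; rewrite eqEsubv subvf -defL -[Em]subfield_closed agenvS //.
  by rewrite subv_add sub1v; apply/span_subvP=> z; rewrite in_zs.
have cardL : #|Fm| = m.
  have /eq_card-> : Fm =i zs by move=> z; rewrite in_zs defEm memvf.
  apply: succn_inj; rewrite (card_uniqP _) //= -(size_prod_XsubC _ id).
  by rewrite -(eqp_size DqL) size_polyDl size_polyXn // size_polyN size_polyX.
apply/eqP; rewrite -(eqn_exp2l _ _ n_gt1) -/m -cardL.
by rewrite -(@card_vspace k (finvect_type L)) card_vspacef.
Qed.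

Definition GFext (k : finFieldType) (e : nat) : fieldExtType k :=
  sval (GFext_exists k e).

Section TruncatedPolynomials.
Variables (k : fieldType) (L : fieldExtType k) (f : nat).

(* [{poly %/ h}] divides by ['X] when [h] is not monic of positive degree, so
   this is L[X]/(X^f) for f > 0. *)
Definition trunc_poly : Type := {poly %/ ('X^f : {poly L})}.

HB.instance Definition _ := GRing.ComUnitRing.on trunc_poly.

Definition trunc_poly_scale (a : k) (p : trunc_poly) : trunc_poly :=
  (a%:A : L) *: (p : {poly %/ ('X^f : {poly L})}).

Fact trunc_poly_scaleA a b p :
  trunc_poly_scale a (trunc_poly_scale b p) = trunc_poly_scale (a * b) p.
Proof. by rewrite /trunc_poly_scale scalerA mulr_algl scalerA. Qed.

Fact trunc_poly_scale1 : left_id 1 trunc_poly_scale.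
Proof. by move=> p; rewrite /trunc_poly_scale !scale1r. Qed.

Fact trunc_poly_scaleDr : right_distributive trunc_poly_scale +%R.
Proof. by move=> a p q; rewrite /trunc_poly_scale -scalerDr. Qed.

Fact trunc_poly_scaleDl p : {morph trunc_poly_scale^~ p : a b / a + b}.
Proof. by move=> a b; rewrite /trunc_poly_scale !scalerDl. Qed.

HB.instance Definition _ := GRing.Zmodule_isLmodule.Build k trunc_poly
  trunc_poly_scaleA trunc_poly_scale1 trunc_poly_scaleDr trunc_poly_scaleDl.

Fact trunc_poly_scaleAl (a : k) (p q : trunc_poly) : a *: (p * q) = a *: p * q.
Proof. exact: scalerAl. Qed.

HB.instance Definition _ :=
  GRing.Lmodule_isLalgebra.Build k trunc_poly trunc_poly_scaleAl.

Fact trunc_poly_scaleAr (a : k) (p q : trunc_poly) : a *: (p * q) = p * (a *: q).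
Proof. exact: scalerAr. Qed.

HB.instance Definition _ :=
  GRing.Lalgebra_isAlgebra.Build k trunc_poly trunc_poly_scaleAr.

Fact trunc_poly_vect_axiom :
  Vector.axiom ((size (mk_monic ('X^f : {poly L}))).-1 * dim L) trunc_poly.
Proof.
set m := _.-1; pose V : vectType k := L.
have v2rP a (u v : V) : v2r (a *: u + v) = a *: v2r u + v2r v by exact: linearP.
pose g (p : trunc_poly) : 'rV[k]_(m * dim V) :=
  mxvec (\matrix_(i < m) v2r ((p : {poly_m L})`_i : V)).
pose h (r : 'rV[k]_(m * dim V)) : trunc_poly := npolyp m
  (\poly_(i < m) (if insub i is Some j then r2v (row j (vec_mx r)) : V else 0)).
exists g.
  move=> a p q; rewrite /g -linearP; congr mxvec; apply/row_matrixP => i.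
  rewrite rowK [RHS]linearP /= !rowK.
  by rewrite coefD coefZ mulr_algl v2rP.
exists h => [p|r].
  apply: val_inj; apply/polyP => i /=; rewrite coef_npolyp coef_poly.
  case: ltnP => [im|mi]; last by rewrite big_coef_npoly.
  by rewrite insubT /= mxvecK rowK v2rK.
apply/(canLR vec_mxK)/row_matrixP => i; rewrite rowK coef_npolyp coef_poly.
by rewrite ltn_ord valK r2vK.
Qed.

HB.instance Definition _ :=
  Lmodule_hasFinDim.Build k trunc_poly trunc_poly_vect_axiom.

End TruncatedPolynomials.

Section ProductAlgebra.
Variables (k : fieldType) (t : nat) (A : 'I_t.+1 -> falgType k).

Definition prod_alg : Type := {dffun forall i, A i}.

HB.instance Definition _ := Choice.copy prod_alg {dffun forall i, A i}.

Implicit Types (x y z : prod_alg) (a b : k).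

Definition prod_alg_zero : prod_alg := [ffun i : 'I_t.+1 => 0 : A i].
Definition prod_alg_one : prod_alg := [ffun i : 'I_t.+1 => 1 : A i].
Definition prod_alg_opp x : prod_alg := [ffun i : 'I_t.+1 => - x i].
Definition prod_alg_add x y : prod_alg := [ffun i : 'I_t.+1 => x i + y i].
Definition prod_alg_mul x y : prod_alg := [ffun i : 'I_t.+1 => x i * y i].
Definition prod_alg_scale a x : prod_alg := [ffun i : 'I_t.+1 => a *: x i].

Fact prod_alg_addA : associative prod_alg_add.
Proof. by move=> x y z; apply/ffunP => i; rewrite !ffunE addrA. Qed.

Fact prod_alg_addC : commutative prod_alg_add.
Proof. by move=> x y; apply/ffunP => i; rewrite !ffunE addrC. Qed.

Fact prod_alg_add0 : left_id prod_alg_zero prod_alg_add.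
Proof. by move=> x; apply/ffunP => i; rewrite !ffunE add0r. Qed.

Fact prod_alg_addN : left_inverse prod_alg_zero prod_alg_opp prod_alg_add.
Proof. by move=> x; apply/ffunP => i; rewrite !ffunE addNr. Qed.

HB.instance Definition _ := GRing.isZmodule.Build prod_alg
  prod_alg_addA prod_alg_addC prod_alg_add0 prod_alg_addN.

Fact prod_alg_mulA : associative prod_alg_mul.
Proof. by move=> x y z; apply/ffunP => i; rewrite !ffunE mulrA. Qed.

Fact prod_alg_mul1 : left_id prod_alg_one prod_alg_mul.
Proof. by move=> x; apply/ffunP => i; rewrite !ffunE mul1r. Qed.

Fact prod_alg_mulr1 : right_id prod_alg_one prod_alg_mul.
Proof. by move=> x; apply/ffunP => i; rewrite !ffunE mulr1. Qed.

Fact prod_alg_mulDl : left_distributive prod_alg_mul +%R.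
Proof. by move=> x y z; apply/ffunP => i; rewrite !ffunE mulrDl. Qed.

Fact prod_alg_mulDr : right_distributive prod_alg_mul +%R.
Proof. by move=> x y z; apply/ffunP => i; rewrite !ffunE mulrDr. Qed.

Fact prod_alg_one_neq0 : prod_alg_one != 0.
Proof.
by apply/eqP => /ffunP /(_ ord0)/eqP; rewrite !ffunE oner_eq0.
Qed.

HB.instance Definition _ := GRing.Zmodule_isNzRing.Build prod_alg
  prod_alg_mulA prod_alg_mul1 prod_alg_mulr1 prod_alg_mulDl prod_alg_mulDr
  prod_alg_one_neq0.

Fact prod_alg_scaleA a b x :
  prod_alg_scale a (prod_alg_scale b x) = prod_alg_scale (a * b) x.
Proof. by apply/ffunP => i; rewrite !ffunE scalerA. Qed.

Fact prod_alg_scale1 : left_id 1 prod_alg_scale.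
Proof. by move=> x; apply/ffunP => i; rewrite !ffunE scale1r. Qed.

Fact prod_alg_scaleDr : right_distributive prod_alg_scale +%R.
Proof. by move=> a x y; apply/ffunP => i; rewrite !ffunE scalerDr. Qed.

Fact prod_alg_scaleDl x : {morph prod_alg_scale^~ x : a b / a + b}.
Proof. by move=> a b; apply/ffunP => i; rewrite !ffunE scalerDl. Qed.

HB.instance Definition _ := GRing.Zmodule_isLmodule.Build k prod_alg
  prod_alg_scaleA prod_alg_scale1 prod_alg_scaleDr prod_alg_scaleDl.

Fact prod_alg_scaleAl a x y : a *: (x * y) = a *: x * y.
Proof. by apply/ffunP => i; rewrite !ffunE scalerAl. Qed.

HB.instance Definition _ :=
  GRing.Lmodule_isLalgebra.Build k prod_alg prod_alg_scaleAl.

Fact prod_alg_scaleAr a x y : a *: (x * y) = x * (a *: y).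
Proof. by apply/ffunP => i; rewrite !ffunE scalerAr. Qed.

HB.instance Definition _ :=
  GRing.Lalgebra_isAlgebra.Build k prod_alg prod_alg_scaleAr.

Fact prod_alg_vect_axiom : Vector.axiom (\sum_i dim (A i)) prod_alg.
Proof.
pose V i : vectType k := A i.
have v2rP i a (u v : V i) : v2r (a *: u + v) = a *: v2r u + v2r v.
  exact: linearP.
exists (fun x : prod_alg => \mxrow_i v2r (x i : V i)).
  by move=> a x y; apply/matrixP => i j; rewrite !mxE !ffunE v2rP !mxE.
exists (fun r => [ffun i : 'I_t.+1 => r2v (submxrow r i) : V i] : prod_alg).
  by move=> x; apply/ffunP => i; rewrite ffunE mxrowK v2rK.
by move=> r; apply/mxrowP => i; rewrite mxrowK ffunE r2vK.
Qed.

HB.instance Definition _ :=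
  Lmodule_hasFinDim.Build k prod_alg prod_alg_vect_axiom.

HB.instance Definition _ := Algebra_isFalgebra.Build k prod_alg.

End ProductAlgebra.

(* The algebra B_s over F_q, for a sequence s of pairs of positive integers;
   entries equal to 0 would give junk factors. *)
Definition Bs (t : nat) (s : t.+1.-tuple (nat * nat)) (q : nat) :
    falgType (GF q) :=
  prod_alg (fun i => trunc_poly (GFext (GF q) (tnth s i).1) (tnth s i).2).

Definition n_of (t : nat) (s : t.+1.-tuple (nat * nat)) : nat :=
  (\sum_(i < t.+1) (tnth s i).1 * (tnth s i).2)%N.

Lemma Bs_mulC (t : nat) (s : t.+1.-tuple (nat * nat)) (q : nat) (x y : Bs s q) :
  x * y = y * x.
Proof. by apply/ffunP => i; rewrite !ffunE mulrC. Qed.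

Lemma dim_Bs (t : nat) (s : t.+1.-tuple (nat * nat)) (q : nat) :
    (forall i, 0 < (tnth s i).1 /\ 0 < (tnth s i).2)%N ->
  \dim {:Bs s q} = n_of s.
Proof.
move=> s_gt0; rewrite dimvf; apply: eq_bigr => i _; have [e_gt0 f_gt0] := s_gt0 i.
rewrite mulnC -[in RHS](svalP (GFext_exists (GF q) (tnth s i).1) e_gt0) dimvf.
congr (_ * _)%N; by rewrite mk_monic_Xn size_polyXn prednK.
Qed.

HB.instance Definition _ (k : finFieldType) (vT : vectType k) :=
  [Finite of {vspace vT} by <:].

Section StarOperations.
Variables (k : finFieldType) (B : falgType k).

Record F0 : predArgType := MkF0 {
  F0_vspace :> {vspace B};
  _ : (F0_vspace * {:B} == {:B})%VS
}.

HB.instance Definition _ := [isSub for F0_vspace].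
HB.instance Definition _ := [Finite of F0 by <:].

Definition colon (I : {vspace B}) (b : B) : {vspace B} := (amull b @^-1: I)%VS.

Lemma memv_colon (I : {vspace B}) (b x : B) : (x \in colon I b) = (b * x \in I).
Proof. by rewrite -memv_preim lfunE. Qed.

Definition closure_operation (star : F0 -> F0) : Prop :=
  [/\ forall I : F0, (I <= star I)%VS,
      forall I J : F0, (I <= J)%VS -> (star I <= star J)%VS
    & forall I : F0, star (star I) = star I].

(* [J] stands for (I : b), which is required to be in F0 for the condition on
   (I : b) to make sense. *)
Definition multiplicative_operation (star : F0 -> F0) : Prop :=
  closure_operation star /\
  forall (I J : F0) (b : B),
    J = colon I b :> {vspace B} -> (star J <= colon (star I) b)%VS.

Fact F0_base_subproof : (1 * {:B} == {:B})%VS.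
Proof. by rewrite prod1v. Qed.

(* The image of k in B. *)
Definition F0_base : F0 := MkF0 F0_base_subproof.

Definition star_operation (star : F0 -> F0) : Prop :=
  multiplicative_operation star /\ star F0_base = F0_base.

Definition Star : {set {ffun F0 -> F0}} :=
  [set star : {ffun F0 -> F0} | `[< star_operation star >]].

End StarOperations.

Definition Lambda (t : nat) (s : t.+1.-tuple (nat * nat)) (q : nat) : nat :=
  #|Star (Bs s q)|.

Definition logb (R : realType) (b x : R) : R := ln x / ln b.

(* The value is meaningful only when q is a prime power. *)
Definition theta (R : realType) (t : nat) (s : t.+1.-tuple (nat * nat))
    (q : nat) : R :=
  logb q%:R (logb 2 (Lambda s q)%:R).

(* Main.v *)
Require Import Defs.
From HB Require Import structures.
From mathcomp Require Import all_boot all_order all_algebra all_field.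
From mathcomp Require Import boolp ring lra zify.

Import Order.TTheory GRing.Theory Num.Theory.

Set Implicit Arguments.
Unset Strict Implicit.
Unset Printing Implicit Defensive.

Local Open Scope ring_scope.

(* A star operation is the same thing as a family of elements of F_0 containing
   k and B and stable under the intersections and the colons (I : b) that lie in
   F_0; by the colons with units, the family is a union of classes under B^*.
   Every element of B is a unit times one of a number of monomials that does not
   depend on q.

   Upper bound: there are boundedly many classes of hyperplanes, because B is a
   Frobenius algebra. About q^3 elements y = b + c x / (1 + a x) have <1, y> in
   the class of <1, x>, unless <1, x> is a subalgebra; and only O(q^3) elements
   generate a subalgebra of dimension 2. Hence there are O(q) classes.

   Lower bound: the subspaces containing an ideal of codimension at most 1,
   together with the planes u<1, e> for u a unit and e an idempotent, form a
   family that remains stable after adding any set of other classes of planes.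
   There are at least q / 4 such classes, since at most (q + 1) q^2 elements y have
   <1, y> in a given class. So log_2 Lambda lies between q / 4 and O(q). *)

(** * Arithmetic of the final estimates *)

Lemma free_planes_arith (F N Q : nat) : (4 * N + 4 <= Q)%N ->
  (Q ^ 4 <= Q + N.*2 * Q ^ 2 + F * (Q.+1 * Q ^ 2))%N -> (Q <= 4 * F)%N.
Proof.
(* If Q > 4 F, each of the three terms on the right is at most Q^4 / 4, and the first is smaller. *)
move=> hN h; rewrite leqNgt; apply/negP => hF.
have h1 : (4 * (F * Q.+1) <= Q * Q)%N by nia.
have h1' := leq_mul h1 (leqnn (Q ^ 2)).
have h2 : (4 * N.*2 <= Q * Q)%N by nia.
have h2' := leq_mul h2 (leqnn (Q ^ 2)).
have h3 : (4 * Q <= Q * Q)%N by nia.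
have h4 : (Q * Q < Q * Q * Q ^ 2)%N.
  by rewrite -{1}[(Q * Q)%N]muln1 ltn_pmul2l; [rewrite -(exp1n 2) ltn_exp2r //; lia | nia].
have e4 : (Q ^ 4 = Q * Q * Q ^ 2)%N by rewrite mulnn -expnD.
move: h h1' h2' h4; rewrite e4 mulnA -!(mulnA 4).
move: (Q * Q * Q ^ 2)%N (F * Q.+1 * Q ^ 2)%N (N.*2 * Q ^ 2)%N => X Y Z.
clear -h3 hN; move: (Q * Q)%N h3 => W; lia.
Qed.

(** Both Q - N and Q - 1 are at least Q / 2, so the left side is at least m Q^3 / 4. *)
Lemma nonalgebra_arith (m N Q : nat) : (4 * N + 4 <= Q)%N ->
  (m * ((Q - N) * (Q * Q.-1)) <= Q ^ 4)%N -> (m <= 4 * Q)%N.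
Proof.
move=> hN hm.
have h1 : (Q <= 2 * (Q - N))%N by lia.
have h2 : (Q <= 2 * Q.-1)%N by lia.
have h3 := leq_mul (leqnn m) (leq_mul h1 (leq_mul (leqnn Q) h2)).
rewrite -(@leq_pmul2r (Q ^ 3)); last by rewrite expn_gt0; lia.
have -> : (4 * Q * Q ^ 3 = 4 * Q ^ 4)%N by rewrite -mulnA -expnS.
apply: leq_trans (leq_mul (leqnn 4) hm); move: h3.
rewrite -[(Q ^ 3)%N]/(Q * (Q * Q))%N => /leq_trans; apply; apply: eq_leq; ring.
Qed.

Lemma algebra_arith (n N Q : nat) : (4 * N + 4 <= Q)%N ->
  (n * (Q * Q.-1) <= N * Q ^ 3 + N * Q ^ 2)%N -> (n <= 2 * N * Q.+1)%N.
Proof.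
move=> hN hn.
have h2 : (Q <= 2 * Q.-1)%N by lia.
have h3 := leq_mul (leqnn n) (leq_mul (leqnn Q) h2).
rewrite -(@leq_pmul2r (Q ^ 2)); last by rewrite expn_gt0; lia.
have -> : (2 * N * Q.+1 * Q ^ 2 = 2 * (N * Q ^ 3 + N * Q ^ 2))%N.
  by rewrite (expnS Q 2); ring.
apply: leq_trans (leq_mul (leqnn 2) hn); move: h3.
rewrite -mulnn => /leq_trans; apply; apply: eq_leq; ring.
Qed.

Lemma classes_arith (m n N Q : nat) : (4 * N + 4 <= Q)%N ->
  (m <= 4 * Q)%N -> (n <= 2 * N * Q.+1)%N -> (m + n + N + 2 <= (2 * N + 6) * Q)%N.
Proof.
move=> hN hm; rewrite mulnS mulnDl; move: (2 * N * Q)%N => X; lia.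
Qed.

(** * Counting, avoidance of subspaces, quadratic identities *)

Lemma card_has_le (T : finType) (S : eqType) (P : S -> T -> bool) (s : seq S) :
  (forall w, w \in s -> forall a b, P w a -> P w b -> a = b) ->
  (#|[set a | has (P^~ a) s]| <= size s)%N.
Proof.
elim: s => [|w s IH] Ps /=.
  by rewrite leqn0 cards_eq0; apply/eqP/setP => a; rewrite !inE.
have -> : [set a | P w a || has (P^~ a) s] = [set a | P w a] :|: [set a | has (P^~ a) s].
  by apply/setP => a; rewrite !inE.
apply: leq_trans (leq_card_setU _ _) _; rewrite -add1n leq_add //; last first.
  by apply: IH => v vs; apply: Ps; rewrite inE vs orbT.
rewrite leqNgt; apply/negP => /card_gt1P[a [b [ha hb /eqP[]]]].
by move: ha hb; rewrite !inE; apply: Ps; rewrite mem_head.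
Qed.

(** If v avoids [Ws] but lies in the next subspace W, take w in I outside W. All points w + a v
    avoid W, and each member of [Ws] contains at most one of them, so some a works. *)
Lemma exists_notin_subspaces (k : finFieldType) (vT : vectType k)
    (I : {vspace vT}) (Ws : seq {vspace vT}) :
  (size Ws < #|k|)%N -> (forall W, W \in Ws -> ~~ (I <= W)%VS) ->
  exists2 v, v \in I & forall W, W \in Ws -> v \notin W.
Proof.
elim: Ws => [|W Ws IH] /= sz sub; first by exists 0; rewrite ?mem0v.
have [|v vI vWs] := IH (ltnW sz); first by move=> U UWs; apply: sub; rewrite inE UWs orbT.
have [vW|vW] := boolP (v \in W); last first.
  by exists v => // U; rewrite inE => /predU1P[->|/vWs].
have /subvPn[w wI wW] := sub W (mem_head _ _).
pose P (U : {vspace vT}) (a : k) := w + a *: v \in U.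
have P1 U : U \in Ws -> forall a b, P U a -> P U b -> a = b.
  move=> UWs a b aU bU; apply/eqP; rewrite -subr_eq0; apply: contraR (vWs U UWs) => ab.
  rewrite -[v](scalerK ab) memvZ // scalerBl.
  by have := memvB aU bU; rewrite opprD addrACA subrr add0r.
have [a aWs] : exists a, ~~ has (P^~ a) Ws.
  apply/existsP; apply: contraTT (leq_ltn_trans (card_has_le P1) (ltnW sz)).
  rewrite negb_exists -leqNgt -cardsT => /forallP hP.
  by apply: subset_leq_card; apply/subsetP => a _; rewrite inE; apply: negbNE.
exists (w + a *: v); first by rewrite memvD ?memvZ.
move=> U; rewrite inE => /predU1P[->|UWs]; last by move/hasPn: aWs => /(_ U UWs).
by apply: contra wW => wavW; rewrite -(addrK (a *: v) w) memvB // memvZ.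
Qed.

Lemma card_fibers_le (S T : finType) (f : S -> T) (A : {set S}) (D : {set T}) (m : nat) :
  (forall x, x \in A -> f x \in D) ->
  (forall y, y \in D -> #|[set x in A | f x == y]| <= m)%N -> (#|A| <= #|D| * m)%N.
Proof.
move=> fAD fm; rewrite -sum1_card (partition_big f (mem D)) //=.
rewrite -sum_nat_const; apply: leq_sum => y yD; apply: leq_trans (fm y yD).
by rewrite -sum1_card; apply: eq_leq; apply: eq_bigl => x; rewrite !inE.
Qed.

Lemma card_fibers_ge (S T : finType) (f : S -> T) (A : {set S}) (D : {set T}) (m : nat) :
  (forall y, y \in D -> m <= #|[set x in A | f x == y]|)%N -> (#|D| * m <= #|A|)%N.
Proof.
move=> fm; pose A' := [set x in A | f x \in D].
apply: (@leq_trans #|A'|); last first.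
  by apply: subset_leq_card; apply/subsetP => x; rewrite inE => /andP[].
rewrite -[#|A'|]sum1_card (partition_big f (mem D)) => [|x]; last by rewrite inE => /andP[].
rewrite -sum_nat_const; apply: leq_sum => y yD; apply: leq_trans (fm y yD) _.
rewrite -sum1_card; apply: eq_leq; apply: eq_bigl => x; rewrite !inE.
by case: eqP => [->|_]; rewrite ?yD ?andbT ?andbF.
Qed.

Lemma functional_neq0 (k : fieldType) (vT : vectType k) (v : vT) : v != 0 ->
  exists phi : 'Hom(vT, k^o), phi v != 0.
Proof.
move=> v0; have vE := coord_vbasis (memvf v).
have [i ci] : exists i, coord (vbasis fullv) i v != 0.
  apply/existsP; apply: contraR v0; rewrite negb_exists => /forallP c0.
  rewrite vE big1 // => i _; have := c0 i; rewrite negbK => /eqP->.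
  by rewrite scale0r.
by exists (linfun (coord (vbasis fullv) i : vT -> k^o)); rewrite lfunE.
Qed.

Lemma discriminant_sqr (A : comNzRingType) (y s n : A) : y * y = n + s * y ->
  (y + y - s) * (y + y - s) = s * s + 4%:R * n.
Proof.
move=> yy; have -> : (y + y - s) * (y + y - s) = 4%:R * (y * y) - 4%:R * (s * y) + s * s by ring.
by rewrite yy; ring.
Qed.

(** For two roots of T^2 = s T + n, this makes (x - y) / (2 x - s) idempotent when 2 x - s is a
    unit. *)
Lemma quadratic_diff (A : comNzRingType) (x y s n : A) :
  x * x = n + s * x -> y * y = n + s * y ->
  (x - y) * (x - y) = (x - y) * (x + x - s).
Proof.
move=> xx yy.
have -> : (x - y) * (x - y) = x * x + y * y - (1 + 1) * (x * y) by ring.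
have -> : (x - y) * (x + x - s) = (1 + 1) * (x * x) - s * x - (1 + 1) * (x * y) + s * y by ring.
by rewrite xx yy; ring.
Qed.

(** * Units, ideals and colons in a commutative algebra *)

Section Structure.
Variables (k : finFieldType) (B : falgType k).
Hypothesis mulC : forall x y : B, x * y = y * x.

Definition comB : comUnitRingType :=
  HB.pack (Falgebra.sort B) (GRing.PzRing_hasCommutativeMul.Build B mulC).

Lemma unitM (x y : B) : (x * y \is a GRing.unit) = (x \is a GRing.unit) && (y \is a GRing.unit).
Proof. exact: (@unitrM comB). Qed.

Local Notation q := #|k|.
Local Notation FB := (finvect_type B).

Lemma unitP (x : B) : reflect (exists y, x * y = 1) (x \is a GRing.unit).
Proof.
apply: (iffP idP) => [ux|[y xy1]]; first by exists x^-1; rewrite divrr.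
by apply/unitrP; exists y; rewrite mulC.
Qed.

Implicit Types (I J K V W : {vspace B}) (b u v x y : B).

Definition has_unit V := exists2 u, u \in V & u \is a GRing.unit.

Definition is_ideal K := forall b x, x \in K -> b * x \in K.

Lemma F0_of_unit V u : u \in V -> u \is a GRing.unit -> (V * {:B} == {:B})%VS.
Proof.
move=> uV uu; rewrite eqEsubv subvf; apply/subvP => x _.
by rewrite -[x](mulVKr uu) memv_mul ?memvf.
Qed.

Lemma memv_pid b y : reflect (exists x, y = b * x) (y \in limg (amull b)).
Proof.
apply: (iffP memv_imgP) => [[x _ ->]|[x ->]]; first by exists x; rewrite lfunE.
by exists x; rewrite ?memvf // lfunE.
Qed.

Lemma pid_ideal b : is_ideal (limg (amull b)).
Proof.
move=> c x /memv_pid[y ->]; apply/memv_pid; exists (c * y).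
by rewrite mulrA [c * b]mulC mulrA.
Qed.

Lemma proper_ideal K u : is_ideal K -> u \in K -> u \is a GRing.unit -> K = {:B}%VS.
Proof.
move=> idK uK uu; apply/eqP; rewrite eqEsubv subvf; apply/subvP => x _.
by rewrite -[x](divrK uu); apply: idK.
Qed.

Lemma pid_unit b u : u \in limg (amull b) -> u \is a GRing.unit -> b \is a GRing.unit.
Proof. by move=> /memv_pid[x ->]; rewrite unitM => /andP[]. Qed.

Lemma colon_colon I b c : colon (colon I b) c = colon I (b * c).
Proof. by apply/vspaceP => x; rewrite !memv_colon mulrA. Qed.

Lemma colon1 I : colon I 1 = I.
Proof. by apply/vspaceP => x; rewrite memv_colon mul1r. Qed.

(** Rank-nullity for multiplication by b, which maps (I : b) onto the intersection of I with bB. *)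
Lemma dim_colon I b :
  \dim (colon I b) = (\dim (lker (amull b)) + \dim (I :&: limg (amull b)))%N.
Proof.
rewrite -(limg_ker_dim (amull b) (colon I b)); congr (_ + _)%N.
  congr (\dim _); apply/capv_idPr/subvP => x; rewrite memv_ker lfunE /= => /eqP bx0.
  by rewrite memv_colon bx0 mem0v.
by rewrite /colon -lpreim_cap_limg lpreimK ?capvSr.
Qed.

Lemma dim_lker_limg b : (\dim (lker (amull b)) + \dim (limg (amull b)))%N = \dim {:B}.
Proof. by rewrite -(limg_ker_dim (amull b) fullv) capfv. Qed.

Lemma dim_colon_unit I u : u \is a GRing.unit -> \dim (colon I u) = \dim I.
Proof.
move=> uu; rewrite dim_colon (eqP (lker0_amull uu)) dimv0 add0n; congr (\dim _).
apply/capv_idPl/subvP => x _; apply/memv_pid; exists (u^-1 * x).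
by rewrite mulVKr.
Qed.

Lemma colon_ideal K b : is_ideal K -> is_ideal (colon K b).
Proof.
move=> idK c x; rewrite !memv_colon mulrA [b * c]mulC -mulrA; exact: idK.
Qed.

Lemma lker_ideal b : is_ideal (lker (amull b)).
Proof.
move=> c x; rewrite !memv_ker !lfunE /= mulrA [b * c]mulC -mulrA => /eqP->.
by rewrite mulr0.
Qed.

(** * Subspaces close to ideals, and split planes *)

Definition almost_ideal I :=
  exists K, [/\ is_ideal K, (K <= I)%VS & (\dim I <= (\dim K).+1)%N].

(** The ideal (K : b) and (I : b) both contain the annihilator of b, so their dimensions differ as
    those of the intersections of K and I with bB, hence by at most 1. *)
Lemma almost_ideal_colon I b : almost_ideal I -> almost_ideal (colon I b).
Proof.
move=> [K [idK KI dimI]]; exists (colon K b); split; first exact: colon_ideal.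
  exact: lpreimS.
rewrite !dim_colon -addnS leq_add2l; set W := limg _.
have := dimv_sum_cap K (I :&: W)%VS.
rewrite capvA (capv_idPl KI) => E.
have : (\dim (K + I :&: W) <= \dim I)%N by rewrite dimvS // subv_add KI capvSl.
lia.
Qed.

(* For b a nonunit, I contains a unit, so I is not contained in bB, and
   the annihilator of b has codimension dim (I cap bB) < dim I in (I : b). *)
Lemma almost_ideal_colon_nonunit I b :
  has_unit I -> b \isn't a GRing.unit -> (\dim I <= 2)%N -> almost_ideal (colon I b).
Proof.
move=> [u uI uu] nb dI; exists (lker (amull b)); split; first exact: lker_ideal.
  apply/subvP => x; rewrite memv_ker lfunE /= => /eqP bx0.
  by rewrite memv_colon bx0 mem0v.
rewrite dim_colon -addn1 leq_add2l.
have : ~~ (I <= limg (amull b))%VS.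
  by apply: contra nb => /subvP/(_ u uI)/pid_unit; apply.
have := dimv_leqif_eq (capvSl I (limg (amull b))).
case; rewrite leq_eqVlt => /orP[/eqP E|lt _ _]; last by apply: leq_trans lt dI.
by rewrite E eqxx => /esym/eqP/capv_idPl ->.
Qed.

(** Such an e is not a scalar, so w and w e are independent and span I. *)
Definition split_plane I :=
  \dim I = 2%N /\ exists w e, [/\ w \is a GRing.unit, e * e = e, e != 0, e != 1 & w \in I /\ w * e \in I].

Lemma split_plane_colon I u : u \is a GRing.unit -> split_plane I -> split_plane (colon I u).
Proof.
move=> uu [dI [w [e [uw ee e0 e1 [wI weI]]]]]; split; first by rewrite dim_colon_unit.
exists (u^-1 * w), e; split; rewrite // ?unitM ?unitrV ?uu //.
by rewrite !memv_colon -!mulrA !mulVKr.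
Qed.

Hypothesis dimB : \dim {:B} = 4%N.

(** For incomparable I and J, the dimensions leave one case where [K :&: L] has codimension above 1
    in [I :&: J]: the latter is a plane, and K and L are complementary planes. A common unit w then
    gives the plane w<1, e>, since w e lies in K and in w + L. *)
Lemma almost_ideal_cap I J :
  has_unit (I :&: J)%VS -> almost_ideal I -> almost_ideal J ->
  [\/ (I <= J)%VS, (J <= I)%VS, almost_ideal (I :&: J)%VS | split_plane (I :&: J)%VS].
Proof.
move=> [w]; rewrite memv_cap => /andP[wI wJ] uw [K [idK KI dI]] [L [idL LJ dJ]].
have [IJ|IJ] := boolP (I <= J)%VS; first by constructor 1.
have [JI|JI] := boolP (J <= I)%VS; first by constructor 2.
have dimlt V W : ~~ (V <= W)%VS -> (\dim (V :&: W) < \dim V)%N.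
  move=> VW; have [le eq] := dimv_leqif_eq (capvSl V W).
  rewrite ltn_neqAle le eq andbT; apply: contra VW => /eqP/capv_idPl; exact.
have d1 := dimlt I J IJ; have d2 := dimlt J I JI; rewrite capvC in d2.
have id0 : is_ideal 0%VS by move=> b x; rewrite !memv0 => /eqP->; rewrite mulr0.
have idC : is_ideal (K :&: L)%VS.
  by move=> b x; rewrite !memv_cap => /andP[xK xL]; rewrite idK ?idL.
have not4 V W : ~~ (V <= W)%VS -> (\dim W <= 3)%N.
  move=> VW; rewrite -ltnS -dimB ltn_neqAle dimvS ?subvf // andbT.
  apply: contra VW => /eqP dW; rewrite (_ : W = {:B}%VS) ?subvf //.
  by apply/eqP; rewrite eqEdim subvf dW /=.
have dI3 := not4 _ _ JI; have dJ3 := not4 _ _ IJ.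
have [dIJ|dIJ] := leqP (\dim (I :&: J)) (\dim (K :&: L)).+1.
  by constructor 3; exists (K :&: L)%VS; split => //; apply: capvS.
have dKL := dimv_sum_cap K L; have dS := dimvS (subvf (K + L)%VS); rewrite dimB in dS.
have [dKL0 dIJ2 dK dL dS4] : [/\ \dim (K :&: L) = 0%N, \dim (I :&: J) = 2%N, \dim K = 2%N,
   \dim L = 2%N & \dim (K + L) = 4%N].
  by split; lia.
(* Here K and L are complementary ideals, and 1 = e + f splits along them. *)
constructor 4; split=> //.
have KL0 : (K :&: L = 0)%VS by apply/eqP; rewrite -dimv_eq0 dKL0.
have KLf : (K + L = {:B})%VS by apply/eqP; rewrite eqEdim subvf dS4 dimB.
have : 1 \in (K + L)%VS by rewrite KLf memvf.
case/memv_addP => e eK [f fL e1].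
have ef0 : e * f = 0.
  by apply/eqP; rewrite -memv0 -KL0 memv_cap mulC idK // mulC idL.
have ee : e * e = e by rewrite -{3}[e]mulr1 e1 mulrDr ef0 addr0.
have nfull V : (\dim V = 2)%N -> is_ideal V -> 1 \notin V.
  move=> dV idV; apply/negP => V1; move: dV.
  by rewrite (proper_ideal idV V1 (unitr1 _)) dimB.
exists w, e; split => //.
- by apply: contra (nfull L dL idL) => /eqP e0; rewrite e1 e0 add0r.
- by apply: contra (nfull K dK idK) => /eqP <-.
split; first by rewrite memv_cap wI.
rewrite memv_cap (subvP KI) ?idK //=.
have -> : w * e = w - w * f by rewrite -{2}[w]mulr1 e1 mulrDr addrK.
by rewrite memvB // (subvP LJ) // idL.
Qed.

(** [R] meets every orbit of the units on B. In the application it lists the monomials, whose number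
    does not depend on q. *)
Variable R : seq B.
Hypothesis RP : forall x, exists u r, [/\ u \is a GRing.unit, r \in R & x = u * r].
Hypothesis Rq : (size R < q)%N.

(** A member of F_0 lies in none of the proper ideals rB with r in [R]. These are fewer than q, so
    some element of I avoids them all, and it is a unit. *)
Lemma F0_has_unit (I : F0 B) : has_unit I.
Proof.
pose Ws := [seq limg (amull r) | r <- R & r \isn't a GRing.unit].
have [||v vI vW] := @exists_notin_subspaces _ _ I Ws.
- by rewrite size_map (leq_ltn_trans _ Rq) // size_filter count_size.
- move=> _ /mapP[r + ->]; rewrite mem_filter => /andP[nr _].
  apply: contra nr => Ir; apply: (@pid_unit r 1); last exact: unitr1.
  have : (I * {:B} <= limg (amull r))%VS.
    by apply/prodvP => u v /(subvP Ir) ur _; rewrite mulC pid_ideal.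
  by rewrite (eqP (valP I)) => /subvP; apply; rewrite memvf.
have [u [r [uu rR E]]] := RP v; exists v => //; rewrite E unitM uu /=.
apply/negPn/negP => nr.
have rW : limg (amull r) \in Ws by apply/mapP; exists r; rewrite // mem_filter nr.
by case/negP: (vW _ rW); apply/memv_pid; exists u; rewrite mulC.
Qed.

(** * Star operations and stable families *)

Definition fixed_set (star : {ffun F0 B -> F0 B}) : {set F0 B} := [set I | star I == I].

(** The intersection of the members of D above I contains I, hence lies in F_0, so the default of
    [insubd] is never taken. *)
Definition star_of (D : {set F0 B}) : {ffun F0 B -> F0 B} :=
  [ffun I : F0 B => insubd I (\bigcap_(J in D | (I <= J)%VS) J)%VS].

Lemma F0_up (I : F0 B) V : (I <= V)%VS -> (V * {:B} == {:B})%VS.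
Proof.
move=> IV; rewrite eqEsubv subvf -{1}(eqP (valP I)); exact: prodvSl.
Qed.

Lemma F0_eq (I J : F0 B) : I = J :> {vspace B} -> I = J.
Proof. exact: val_inj. Qed.

Lemma star_ofE (D : {set F0 B}) (I : F0 B) :
  star_of D I = (\bigcap_(J in D | (I <= J)%VS) J)%VS :> {vspace B}.
Proof.
rewrite ffunE -[LHS]/(val _) insubdK //; apply: (@F0_up I).
by apply/subv_bigcapP => J /andP[].
Qed.

Lemma star_of_sub (D : {set F0 B}) (I J : F0 B) :
  J \in D -> (I <= J)%VS -> (star_of D I <= J)%VS.
Proof. by move=> JD IJ; rewrite star_ofE; apply: (@bigcapv_inf _ _ _ J); rewrite ?JD /= ?subvv. Qed.

Lemma sub_star_of (D : {set F0 B}) (I : F0 B) : (I <= star_of D I)%VS.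
Proof. by rewrite star_ofE; apply/subv_bigcapP => J /andP[]. Qed.

Section ClosedFamily.
Variable D : {set F0 B}.
Hypothesis D_full : forall I : F0 B, I = {:B}%VS :> {vspace B} -> I \in D.
Hypothesis D_cap : forall I J M : F0 B, I \in D -> J \in D ->
  M = (I :&: J)%VS :> {vspace B} -> M \in D.
Hypothesis D_colon : forall (I J : F0 B) b, I \in D ->
  J = colon I b :> {vspace B} -> J \in D.
Hypothesis D_base : F0_base B \in D.

Lemma star_of_mem (I : F0 B) : star_of D I \in D.
Proof.
pose P V := (I <= V)%VS /\ forall J : F0 B, J = V :> {vspace B} -> J \in D.
have : P (star_of D I); last by case=> _; apply.
rewrite star_ofE; apply: big_ind => [|V W [IV VD] [IW WD]|J /andP[JD IJ]].
- by split; [apply: subvf | exact: D_full].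
- split; first by rewrite subv_cap IV.
  move=> J EJ; apply: D_cap (VD (MkF0 (F0_up IV)) erefl) (WD (MkF0 (F0_up IW)) erefl) EJ.
- by split=> // M /F0_eq->.
Qed.

Lemma fixed_star_of : fixed_set (star_of D) = D.
Proof.
apply/setP => I; rewrite inE; apply/eqP/idP => [<-|ID]; first exact: star_of_mem.
by apply/F0_eq/eqP; rewrite eqEsubv sub_star_of andbT star_of_sub.
Qed.

(** For multiplicativity, (I^* : b) contains (I : b), so it lies in F_0 and hence in D, and
    therefore contains the closure of (I : b). *)
Lemma star_of_star : star_operation (star_of D).
Proof.
have fx (I : F0 B) : I \in D -> star_of D I = I.
  by rewrite -{1}fixed_star_of inE => /eqP.
split; last exact: fx.
split; first split=> [I|I J IJ|I].
- exact: sub_star_of.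
- by apply: star_of_sub (star_of_mem J) _; apply: subv_trans IJ (sub_star_of _ _).
- exact/fx/star_of_mem.
move=> I J b EJ.
have JC : (J <= colon (star_of D I) b)%VS by rewrite EJ; apply/lpreimS/sub_star_of.
apply: (@star_of_sub D J (MkF0 (F0_up JC))) => //.
exact: D_colon (star_of_mem I) _.
Qed.

End ClosedFamily.

(** The closure of I is the least fixed point above I. *)
Lemma fixed_set_inj (s1 s2 : {ffun F0 B -> F0 B}) :
  star_operation s1 -> star_operation s2 -> fixed_set s1 = fixed_set s2 -> s1 = s2.
Proof.
have half (s t : {ffun F0 B -> F0 B}) : star_operation s -> star_operation t -> fixed_set s = fixed_set t ->
    forall I : F0 B, (s I <= t I)%VS.
  move=> [[[ext1 mon1 idem1] _] _] [[[ext2 mon2 idem2] _] _] E I.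
  have : t I \in fixed_set s by rewrite E inE idem2.
  by rewrite inE => /eqP <-; apply: mon1.
move=> h1 h2 E; apply/ffunP => I; apply/F0_eq/eqP; rewrite eqEsubv.
by rewrite !half.
Qed.

(** For a unit u, (I : u) = u^{-1} I, so this is the orbit relation of the unit group. *)
Definition assoc_F0 (I J : F0 B) : bool :=
  `[< exists2 u, u \is a GRing.unit & J = colon I u :> {vspace B} >].

Lemma assoc_F0P (I J : F0 B) :
  reflect (exists2 u, u \is a GRing.unit & J = colon I u :> {vspace B}) (assoc_F0 I J).
Proof. exact: asboolP. Qed.

Lemma assoc_F0_refl (I : F0 B) : assoc_F0 I I.
Proof. by apply/assoc_F0P; exists 1; rewrite ?unitr1 ?colon1. Qed.

Lemma assoc_F0_sym (I J : F0 B) : assoc_F0 I J -> assoc_F0 J I.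
Proof.
move=> /assoc_F0P[u uu EJ]; apply/assoc_F0P; exists u^-1; first by rewrite unitrV.
by rewrite EJ colon_colon divrr // colon1.
Qed.

Lemma assoc_F0_trans (I J K : F0 B) : assoc_F0 I J -> assoc_F0 J K -> assoc_F0 I K.
Proof.
move=> /assoc_F0P[u uu EJ] /assoc_F0P[v uv EK]; apply/assoc_F0P.
by exists (u * v); rewrite ?unitM ?uu // EK EJ colon_colon.
Qed.

Definition canon (I : F0 B) : F0 B := choose (assoc_F0 I) I.

Lemma assoc_canon (I : F0 B) : assoc_F0 I (canon I).
Proof. by apply: chooseP; apply: assoc_F0_refl. Qed.

Lemma canonE (I J : F0 B) : assoc_F0 I J -> canon I = canon J.
Proof.
move=> IJ; rewrite /canon (@choose_id _ (assoc_F0 I) I J) ?assoc_F0_refl //.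
apply: eq_choose => K; apply/idP/idP; last exact: assoc_F0_trans IJ.
exact: assoc_F0_trans (assoc_F0_sym IJ).
Qed.

Lemma eq_canon (I J : F0 B) : canon I = canon J -> assoc_F0 I J.
Proof.
move=> E; apply: assoc_F0_trans (assoc_canon I) _; rewrite E.
exact/assoc_F0_sym/assoc_canon.
Qed.

Lemma canonK (I : F0 B) : canon (canon I) = canon I.
Proof. by apply/esym/canonE/assoc_canon. Qed.

Lemma fixed_set_assoc (star : {ffun F0 B -> F0 B}) (I J : F0 B) :
  star_operation star -> assoc_F0 I J -> I \in fixed_set star -> J \in fixed_set star.
Proof.
move=> [[[ext _ _] mul] _] /assoc_F0P[u uu EJ]; rewrite !inE => /eqP fI.
apply/eqP/F0_eq/eqP; rewrite eqEsubv ext andbT.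
by have := mul I J u EJ; rewrite fI -EJ.
Qed.

Definition classes : {set F0 B} := [set canon I | I : F0 B].

(** The fixed set of a star operation is a union of orbits, so the representatives in it determine
    the operation. *)
Lemma card_Star_le : (#|Star B| <= 2 ^ #|classes|)%N.
Proof.
rewrite -card_powerset.
rewrite -(@card_in_imset _ _ (fun s => fixed_set s :&: classes) (mem (Star B))); last first.
  move=> s t; rewrite !inE => /asboolP hs /asboolP ht E; apply: fixed_set_inj => //.
  apply/setP => I.
  have cI : canon I \in classes by apply: imset_f.
  have h (r : {ffun F0 B -> F0 B}) : star_operation r -> (I \in fixed_set r) = (canon I \in fixed_set r :&: classes).
    move=> hr; rewrite in_setI cI andbT; apply/idP/idP; apply: fixed_set_assoc => //.
      exact: assoc_canon.
    exact/assoc_F0_sym/assoc_canon.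
  by rewrite !h // E.
apply: subset_leq_card; apply/subsetP => _ /imsetP[s _ ->].
by rewrite inE subsetIr.
Qed.

Definition special V := almost_ideal V \/ split_plane V.

Definition free_planes : {set F0 B} :=
  [set I in classes | (\dim I == 2%N) && ~~ `[< special I >]].

Lemma special_assoc (I J : F0 B) : assoc_F0 I J -> special I -> special J.
Proof.
move=> /assoc_F0P[u uu ->] [sI|sI]; first by left; apply: almost_ideal_colon.
by right; apply: split_plane_colon.
Qed.

Lemma small_almost_ideal V : (\dim V <= 1)%N -> almost_ideal V.
Proof.
move=> dV; exists 0%VS; split; rewrite ?sub0v ?dimv0 // => b x.
by rewrite !memv0 => /eqP->; rewrite mulr0.
Qed.

Section FreeFamily.
Variable S : {set F0 B}.
Hypothesis S_free : S \subset free_planes.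

Definition free_family : {set F0 B} := [set I : F0 B | `[< special I >] || (canon I \in S)].

Lemma free_family_dim (I : F0 B) : canon I \in S -> \dim I = 2%N.
Proof.
move=> /(subsetP S_free); rewrite inE => /andP[_ /andP[/eqP <- _]].
by have /assoc_F0P[u uu ->] := assoc_canon I; rewrite dim_colon_unit.
Qed.

Lemma free_family_special (I : F0 B) : special I -> I \in free_family.
Proof. by move=> sI; rewrite inE; apply/orP; left; apply/asboolP. Qed.

(** Only intersections of two almost ideals need work: incomparable members, one of them a plane,
    meet in dimension at most 1, and such a subspace is special. Colons by units preserve orbits,
    and colons of members by nonunits are almost ideals. *)
Lemma free_family_star : star_operation (star_of free_family) /\
  fixed_set (star_of free_family) = free_family.
Proof.
have dim2 (I : F0 B) : I \in free_family -> almost_ideal I \/ \dim I = 2%N.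
  by rewrite inE => /orP[/asboolP[|[]]|/free_family_dim]; auto.
have Dfull (I : F0 B) : I = {:B}%VS :> {vspace B} -> I \in free_family.
  move=> E; apply: free_family_special; left; exists {:B}%VS.
  by split=> [b x _||]; rewrite ?memvf ?E ?subvv // ltnW.
have Dcap (I J M : F0 B) : I \in free_family -> J \in free_family ->
    M = (I :&: J)%VS :> {vspace B} -> M \in free_family.
  move=> hI hJ EM.
  have [IJ|IJ] := boolP (I <= J)%VS.
    by rewrite (@F0_eq M I) // EM; apply/capv_idPl.
  have [JI|JI] := boolP (J <= I)%VS.
    by rewrite (@F0_eq M J) // EM; apply/capv_idPr.
  have small V W : ~~ (V <= W)%VS -> \dim V = 2%N -> (\dim (V :&: W) <= 1)%N.
    move=> VW dV; rewrite -ltnS -dV; have [le eq] := dimv_leqif_eq (capvSl V W).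
    by rewrite ltn_neqAle le eq andbT; apply: contra VW => /eqP/capv_idPl.
  have sm : (\dim M <= 1)%N -> M \in free_family.
    by move=> dM; apply/free_family_special; left; apply: small_almost_ideal.
  have [aI|dI] := dim2 I hI; last by apply: sm; rewrite EM small.
  have [aJ|dJ] := dim2 J hJ; last by apply: sm; rewrite EM capvC small.
  have uM : has_unit (I :&: J)%VS by rewrite -EM; apply: F0_has_unit.
  case: (almost_ideal_cap uM aI aJ) => h.
  - by case/negP: IJ.
  - by case/negP: JI.
  - by apply: free_family_special; left; rewrite EM.
  - by apply: free_family_special; right; rewrite EM.
have Dcolon (I J : F0 B) b : I \in free_family -> J = colon I b :> {vspace B} ->
    J \in free_family.
  move=> hI EJ; have [ub|nb] := boolP (b \is a GRing.unit).
    have IJ : assoc_F0 I J by apply/assoc_F0P; exists b.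
    move: hI; rewrite !inE => /orP[/asboolP sI|cI]; apply/orP; [left|right].
      exact/asboolP/(special_assoc IJ sI).
    by rewrite -(canonE IJ).
  apply: free_family_special; left; rewrite EJ.
  have [aI|dI] := dim2 I hI; first exact: almost_ideal_colon.
  by apply: almost_ideal_colon_nonunit (F0_has_unit I) nb _; rewrite dI.
have Dbase : F0_base B \in free_family.
  by apply: free_family_special; left; apply: small_almost_ideal; rewrite dimv1.
by split; [apply: star_of_star | apply: fixed_star_of].
Qed.

(** This recovers S from the family, so different S give different star operations. *)
Lemma free_family_cap : free_family :&: free_planes = S.
Proof.
apply/setP => I; rewrite inE; apply/andP/idP => [[]|IS].
  rewrite !inE => /orP[/asboolP sI|cI] /andP[/imsetP[J _ EI] /andP[_ /asboolP nsI]] //.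
  by move: cI; rewrite EI canonK.
have := subsetP S_free I IS => If; split=> //; rewrite inE.
move: If; rewrite inE => /andP[/imsetP[J _ EI] _]; apply/orP; right.
by rewrite EI canonK -EI.
Qed.

End FreeFamily.

Lemma card_Star_ge : (2 ^ #|free_planes| <= #|Star B|)%N.
Proof.
rewrite -card_powerset.
rewrite -(@card_in_imset _ _ (fun S => star_of (free_family S)) (mem (powerset free_planes))).
  apply: subset_leq_card; apply/subsetP => _ /imsetP[S hS ->]; rewrite powersetE in hS.
  by rewrite inE; apply/asboolP; have [] := free_family_star hS.
move=> S T; rewrite !powersetE => hS hT E.
rewrite -(free_family_cap hS) -(free_family_cap hT).
by have [_ <-] := free_family_star hS; have [_ <-] := free_family_star hT; rewrite E.
Qed.

(** * Classes of planes *)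

Lemma card_FB : #|{: FB}| = (q ^ 4)%N.
Proof. by rewrite -dimB -(card_vspace (fullv : {vspace FB})) card_vspacef. Qed.

(** A plane when x is not a scalar. Division by a unit brings every plane of F_0 to this form. *)
Definition line x : {vspace B} := (1 + <[x]>)%VS.

Lemma memv_line1 x y : reflect (exists a b : k, y = a%:A + b *: x) (y \in line x).
Proof.
apply: (iffP memv_addP) => [[_ /vlineP[a ->] [_ /vlineP[b ->] ->]]|[a [b ->]]].
  by exists a, b.
exists a%:A; first by rewrite memvZ // memv_line.
by exists (b *: x); rewrite // memvZ // memv_line.
Qed.

Lemma line_1 x : 1 \in line x.
Proof. by apply/memv_line1; exists 1, 0; rewrite scale0r addr0 scale1r. Qed.

Lemma line_id x : x \in line x.
Proof. by apply/memv_line1; exists 0, 1; rewrite scale0r add0r scale1r. Qed.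

Lemma line_comb x (a b : k) : a%:A + b *: x \in line x.
Proof. by apply/memv_line1; exists a, b. Qed.

Lemma memv_alg (a : k) : a%:A \in (1%VS : {vspace B}).
Proof. by apply/vlineP; exists a. Qed.

Lemma line_coef_inj x (a b a' b' : k) : x \notin 1%VS ->
  a%:A + b *: x = a'%:A + b' *: x -> a = a' /\ b = b'.
Proof.
move=> x1 E; have {}E : (b - b') *: x = (a' - a)%:A.
  by rewrite !scalerBl; apply/eqP; rewrite subr_eq addrAC eq_sym subr_eq -E addrC.
have [bb'|bb'] := eqVneq (b - b') 0.
  split; last exact/subr0_eq.
  move: E; rewrite bb' scale0r => /esym/eqP.
  by rewrite scaler_eq0 oner_eq0 orbF subr_eq0 => /eqP.
by case/negP: x1; rewrite -[x](scalerK bb') E memvZ // memv_alg.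
Qed.

Lemma dim_line x : x \notin 1%VS -> \dim (line x) = 2%N.
Proof.
move=> x1; rewrite /line dimv_disjoint_sum ?dimv1 ?dim_vline.
  by case: eqP x1 => // ->; rewrite mem0v.
apply/eqP; rewrite -subv0; apply/subvP => y; rewrite memv_cap memv0.
move=> /andP[/vlineP[a ya] /vlineP[b yb]].
have := @line_coef_inj x a 0 0 b x1; rewrite scale0r addr0 scale0r add0r -ya -yb.
by case=> // a0 _; rewrite ya a0 scale0r.
Qed.

Lemma line_F0 x : (line x * {:B} == {:B})%VS.
Proof. exact: F0_of_unit (line_1 x) (unitr1 _). Qed.

Definition lineF0 x : F0 B := MkF0 (line_F0 x).

Lemma line_eq V x : \dim V = 2%N -> x \notin 1%VS -> 1 \in V -> x \in V -> line x = V.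
Proof.
move=> dV x1 V1 Vx; apply/eqP; rewrite eqEdim dim_line // dV leqnn andbT.
by rewrite subv_add -!memvE V1.
Qed.

Lemma assoc_lineP x y : x \notin 1%VS -> y \notin 1%VS ->
  reflect (exists u, [/\ u \is a GRing.unit, u \in line x & u * y \in line x])
          (assoc_F0 (lineF0 x) (lineF0 y)).
Proof.
move=> x1 y1; apply: (iffP (assoc_F0P _ _)) => [[u uu /= E]|[u [uu ux uyx]]].
  exists u; split=> //; first by rewrite -[u]mulr1 -memv_colon -E line_1.
  by rewrite -memv_colon -E line_id.
exists u => //=; apply: line_eq => //; first by rewrite dim_colon_unit // dim_line.
  by rewrite memv_colon mulr1.
by rewrite memv_colon.
Qed.

(* Stands for the class of <1, x>, through the generators y of its planes <1, y>. *)
Definition fiber x : {set FB} :=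
  [set y : FB | ((y : B) \notin 1%VS) && assoc_F0 (lineF0 x) (lineF0 y)].

(** Here u y = c + d x for a unit u of <1, x>. There are q^2 numerators, and up to scalars at most q
    + 1 denominators u: the elements 1 + a x, and x for [None]. *)
Lemma card_fiber_le x : x \notin 1%VS -> (#|fiber x| <= q.+1 * q ^ 2)%N.
Proof.
move=> x1.
pose den (o : option k) : B := if o is Some a then 1 + a *: x else x.
pose g (p : option k * (k * k)) : FB := (p.2.1%:A + p.2.2 *: x) * (den p.1)^-1.
have -> : (q.+1 * q ^ 2)%N = #|{: option k * (k * k)}|.
  by rewrite !card_prod card_option mulnn.
rewrite -cardsT; apply: leq_trans (leq_imset_card g _).
apply: subset_leq_card; apply/subsetP => y; rewrite inE => /andP[y1].
move=> /(assoc_lineP x1 y1)[u [uu /memv_line1[a [b ub]] /memv_line1[c [d uy]]]].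
have key o e : e != 0 -> e *: u = den o -> y \in g @: setT.
  move=> e0 eu; apply/imsetP; exists (o, (e * c, e * d)) => //=; rewrite /g /=.
  have ud : den o \is a GRing.unit by rewrite -eu scaler_unit // unitfE.
  rewrite -[LHS](mulKr ud) mulC; congr (_ * _).
  by rewrite -eu -scalerAl uy scalerDr !scalerA.
have [a0|a0] := eqVneq a 0.
  apply: (key None b^-1); last first.
    rewrite ub a0 scale0r add0r scalerK //; apply/eqP => b0.
    by move: uu; rewrite ub a0 b0 !scale0r addr0 unitr0.
  rewrite invr_eq0; apply/eqP => b0.
  by move: uu; rewrite ub a0 b0 !scale0r addr0 unitr0.
apply: (key (Some (a^-1 * b)) a^-1); first by rewrite invr_eq0.
by rewrite ub scalerDr !scalerA mulVf // scale1r.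
Qed.

Lemma card_line_le x : x \notin 1%VS ->
  (q * q.-1 <= #|[set y : FB | (y \notin (1%VS : {vspace B})) && (y \in line x)]|)%N.
Proof.
move=> x1; pose g (p : k * k) : FB := p.1%:A + p.2 *: x.
have -> : (q * q.-1)%N = #|setX [set: k] [set~ (0 : k)]|.
  by rewrite cardsX cardsT cardsC1.
have ginj : injective g.
  by move=> [a b] [a' b'] /(line_coef_inj x1) /= [-> ->].
rewrite -(card_imset _ ginj).
apply: subset_leq_card; apply/subsetP => _ /imsetP[[a b] + ->].
rewrite !inE /= => b0; rewrite line_comb andbT; apply: contra b0 => /vlineP[c].
rewrite -[RHS]addr0 -(scale0r x) => /(line_coef_inj x1) /= [_ ->]; apply: eqxx.
Qed.

Definition unit_slopes x : {set k} := [set a : k | 1 + a *: x \is a GRing.unit].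

(** A proper ideal rB contains 1 + a x for at most one a: two such elements would put x, and then 1,
    in rB. *)
Lemma card_unit_slopes x : x \notin 1%VS ->
  (q - size R <= #|unit_slopes x|)%N.
Proof.
move=> x1; rewrite leq_subLR -(cardsC (unit_slopes x)) addnC leq_add2r.
pose P r a := (r \isn't a GRing.unit) && (1 + a *: x \in limg (amull r)).
have : (#|[set a | has (P^~ a) R]| <= size R)%N.
  apply: card_has_le => r _ a b /andP[nr ra] /andP[_ rb].
  apply/eqP; rewrite -subr_eq0; apply: contraR nr => ab.
  apply: (@pid_unit r 1); last exact: unitr1.
  have rx : x \in limg (amull r).
    rewrite -[x](scalerK ab) memvZ // scalerBl.
    by have := memvB ra rb; rewrite opprD addrACA subrr add0r.
  by rewrite -[1](addrK (a *: x)) memvB // memvZ.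
apply: leq_trans; apply: subset_leq_card; apply/subsetP => a; rewrite !inE => na.
apply/hasP; have [u [r [uu rR E]]] := RP (1 + a *: x); exists r => //.
rewrite /P; move: na; rewrite E unitM uu /= => -> /=.
by apply/memv_pid; exists u; rewrite mulC.
Qed.

(* If <1, x> is not a subalgebra, then only scalars map it to itself, which makes
   (a, b, c) |-> b + c x / (1 + a x) injective. *)
Lemma card_fiber_ge x : x \notin 1%VS -> x * x \notin line x ->
  ((q - size R) * (q * q.-1) <= #|fiber x|)%N.
Proof.
move=> x1 xx; pose U := unit_slopes x.
pose g (p : k * (k * k)) : FB := p.2.1%:A + p.2.2 *: (x * (1 + p.1 *: x)^-1).
apply: (@leq_trans #|setX U (setX [set: k] [set~ (0 : k)])|).
  by rewrite !cardsX cardsT cardsC1 leq_mul2r card_unit_slopes ?orbT.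
have gu (a b c : k) : a \in U -> (1 + a *: x) * g (a, (b, c)) = b%:A + (b * a + c) *: x.
  rewrite inE => ua; rewrite /g /= mulrDr -!scalerAr mulr1.
  rewrite [x * _]mulC mulVKr // scalerDr scalerA -addrA -scalerDl //.
have gx (a b c : k) : a \in U -> c != 0 -> g (a, (b, c)) \in fiber x.
  move=> aU c0; have := aU; rewrite inE => ua.
  have y1 : (g (a, (b, c)) : B) \notin 1%VS.
    apply: contra c0 => /vlineP[d yd]; have := gu a b c aU.
    rewrite yd -scalerAr mulr1 scalerDr scalerA => /(line_coef_inj x1)[<-].
    by move/eqP; rewrite -subr_eq0 opprD addNKr oppr_eq0.
  rewrite inE y1; apply/(assoc_lineP x1 y1).
  exists (1 + a *: x); split=> //; last by rewrite gu // line_comb.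
  by rewrite -[1]scale1r line_comb.
have ginj : {in setX U (setX [set: k] [set~ (0 : k)]) &, injective g}.
  move=> [a [b c]] [a' [b' c']]; rewrite !inE /= => /andP[ua c0] /andP[ua' c0'] E.
  have aU : a \in U by rewrite inE.
  have aU' : a' \in U by rewrite inE.
  set u := 1 + a *: x in ua; set u' := 1 + a' *: x in ua'.
  have y1 : (g (a, (b, c)) : B) \notin 1%VS by have := gx a b c aU c0; rewrite inE => /andP[].
  have lcolon (a0 b0 d0 : k) : a0 \in U -> d0 != 0 -> (g (a0, (b0, d0)) : B) \notin 1%VS ->
      line (g (a0, (b0, d0))) = colon (line x) (1 + a0 *: x).
    move=> a0U c00 g1; apply: line_eq => //.
    - by rewrite dim_colon_unit ?dim_line //; move: a0U; rewrite inE.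
    - by rewrite memv_colon mulr1 -[1]scale1r line_comb.
    - by rewrite memv_colon gu // line_comb.
  have EC : colon (line x) u = colon (line x) u'.
    by rewrite -(lcolon a b c) // -(lcolon a' b' c') -?E.
  (* The ratio u' / u maps <1, x> to itself, so it is some al + be x. If be were nonzero, applying
     it to x would put x^2 in <1, x>. *)
  have stab z : z \in line x -> (u' * u^-1) * z \in line x.
    by move=> zx; rewrite -mulrA -memv_colon -EC memv_colon mulVKr.
  have /memv_line1[al [be Ew]] : u' * u^-1 \in line x by rewrite -[_ * _]mulr1 stab ?line_1.
  have be0 : be = 0.
    apply/eqP; apply: contraR xx => be0; rewrite -[x * x](scalerK be0) memvZ //.
    have := stab x (line_id x); rewrite Ew mulrDl -!scalerAl mul1r => h.
    by rewrite -(addKr (al *: x) (be *: _)) memvD ?memvN ?memvZ ?line_id.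
  have {}Ew : u' = al *: u.
    by rewrite -[LHS](divrK ua) Ew be0 scale0r addr0 -scalerAl mul1r.
  have [al1 aa] : al = 1 /\ al * a = a'.
    by apply: (line_coef_inj x1); rewrite -scalerA -scalerDr -/u -Ew scale1r.
  have {}aa : a = a' by rewrite -aa al1 mul1r.
  have := gu a b c aU; rewrite E aa gu // => /(line_coef_inj x1)[-> /addrI->] //.
rewrite -(card_in_imset ginj).
apply: subset_leq_card; apply/subsetP => _ /imsetP[[a [b c]] + ->].
by rewrite !inE /= => /andP[ua c0]; have := gx a b c; rewrite !inE; apply.
Qed.

(** * Planes <1, x> of special type *)

(** [RP] supplies u before r; the two are exchanged so that [cid] chooses r. *)
Definition rep x : B := sval (cid (let: ex_intro u (ex_intro r P) := RP x in
  ex_intro (fun r => exists u, [/\ u \is a GRing.unit, r \in R & x = u * r]) r (ex_intro _ u P))).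

Lemma repP x : exists u, [/\ u \is a GRing.unit, rep x \in R & x = u * rep x].
Proof. by rewrite /rep; case: cid => r [u P]; exists u. Qed.

Lemma rep_in x : rep x \in R.
Proof. by have [u []] := repP x. Qed.

Lemma card_R : (#|[set r : FB | (r : B) \in R]| <= size R)%N.
Proof. by rewrite cardsE; apply: card_size. Qed.

Definition idempotents : {set FB} := [set e : FB | (e : B) * e == e].

(** Idempotents e and f with the same representative are unit multiples of each other, which gives f
    e = f and e f = e. *)
Lemma card_idempotents : (#|idempotents| <= size R)%N.
Proof.
apply: leq_trans card_R; rewrite -(@card_in_imset _ _ (rep : FB -> FB) (mem idempotents)).
  by apply: subset_leq_card; apply/subsetP => _ /imsetP[e _ ->]; rewrite inE rep_in.
have half (e f : B) : e * e = e -> f * f = f -> rep e = rep f -> f * e = f.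
  move=> ee ff; have [u [uu _ eu]] := repP e; have [v [uv _ fv]] := repP f => E.
  have -> : f = v * u^-1 * e by rewrite -mulrA eu mulKr // E.
  by rewrite -mulrA ee.
move=> e f; rewrite !inE => /eqP ee /eqP ff E.
by rewrite -(half f e) // mulC half.
Qed.

Lemma line_mul x u v : x * x \in line x -> u \in line x -> v \in line x -> u * v \in line x.
Proof.
move=> xx /memv_line1[a [b ->]] /memv_line1[c [d ->]].
rewrite mulrDl !mulrDr -!scalerAl -!scalerAr !mul1r mulr1.
by rewrite !memvD // ?memvZ // ?line_1 // line_id.
Qed.

(** A unit u of the subalgebra <1, x> maps it onto itself, so it is the only plane of its class that
    contains 1. *)
Lemma line_assoc_alg x y : x \notin 1%VS -> y \notin 1%VS -> x * x \in line x ->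
  assoc_F0 (lineF0 x) (lineF0 y) -> y \in line x.
Proof.
move=> x1 y1 xx /(assoc_lineP x1 y1)[u [uu ux uyx]].
rewrite [line x](_ : _ = colon (line x) u) ?memv_colon //.
by apply: line_eq => //; rewrite ?dim_colon_unit ?dim_line // memv_colon ?mulr1 // line_mul ?line_id.
Qed.

Definition special_lines : {set FB} :=
  [set y : FB | ((y : B) \notin 1%VS) && `[< special (line y) >]].

(** Each special <1, y> is <1, r> with r in [R] or idempotent. A nonzero ideal inside <1, y>
    contains the representative in [R] of any of its nonzero elements, which is not a scalar; a
    split plane is in the class of the subalgebra <1, e>, hence equal to it. *)
Lemma card_special_lines : (#|special_lines| <= (size R).*2 * q ^ 2)%N.
Proof.
pose S := [set r : FB | (r : B) \in R] :|: idempotents.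
pose g (p : FB * (k * k)) : FB := p.2.1%:A + p.2.2 *: p.1.
apply: (@leq_trans #|setX S [set: k * k]|); last first.
  rewrite cardsX cardsT card_prod mulnn leq_mul2r -addnn; apply/orP; right.
  by apply: leq_trans (leq_card_setU _ _) _; rewrite leq_add ?card_R ?card_idempotents.
apply: leq_trans (leq_imset_card g _).
apply: subset_leq_card; apply/subsetP => y; rewrite inE => /andP[y1 /asboolP sy].
suff [r rS /memv_line1[a [b yE]]] : exists2 r : FB, r \in S & y \in line r.
  by apply/imsetP; exists (r, (a, b)); rewrite // !inE andbT; rewrite !inE in rS.
case: sy => [[K [idK Ky dK]]|[dy [w [e [uw ee e0 e1 [wy wey]]]]]].
  rewrite dim_line // in dK.
  have K1 : 1 \notin K.
    apply/negP => K1; have := dimvS Ky; rewrite (proper_ideal idK K1 (unitr1 _)).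
    by rewrite dim_line // dimB.
  have K0 : K != 0%VS by rewrite -dimv_eq0 -lt0n.
  have [u [uu rR dE]] := repP (vpick K).
  have rK : rep (vpick K) \in K by rewrite -[rep _](mulKr uu) -dE idK ?memv_pick.
  exists (rep (vpick K)); first by rewrite !inE rR.
  have /memv_line1[a [b rE]] := subvP Ky _ rK.
  have b0 : b != 0.
    apply: contra K1 => /eqP b0; move: rE; rewrite b0 scale0r addr0 => rE.
    have a0 : a != 0.
      by apply: contra K0 => /eqP a0; rewrite -vpick0 dE rE a0 scale0r mulr0.
    by rewrite -[1](scalerK a0) -rE memvZ.
  rewrite -[y : B](scalerK b0) memvZ // -(addKr a%:A (b *: _)) -rE memvD ?line_id //.
  by rewrite memvN memvZ // line_1.
have ne1 : e \notin 1%VS.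
  apply/negP => /vlineP[c ec]; move: ee; rewrite ec -scalerAl mul1r scalerA => /eqP.
  rewrite -subr_eq0 -scalerBl scaler_eq0 oner_eq0 orbF -{3}[c]mulr1 -mulrBr mulf_eq0 subr_eq0.
  by case/orP=> /eqP c0; [move: e0 | move: e1]; rewrite ec c0 ?scale0r ?scale1r eqxx.
exists e; first by rewrite !inE; apply/orP; right; apply/eqP.
apply: line_assoc_alg => //; first by rewrite [X in X \in _]ee line_id.
apply/assoc_F0_sym/assoc_F0P; exists w => //=.
by apply: line_eq => //; rewrite ?dim_colon_unit // memv_colon ?mulr1.
Qed.

Definition square_zero : {set FB} := [set e : FB | (e : B) * e == 0].

(** If e = u r squares to 0, so does r. Then rB lies in the annihilator of r, so dim rB <= 2, and e
    is one of at most q^2 elements of rB. *)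
Lemma card_square_zero : (#|square_zero| <= size R * q ^ 2)%N.
Proof.
apply: (@leq_trans (#|[set r : FB | (r : B) \in R]| * q ^ 2)%N); last first.
  by rewrite leq_mul2r card_R orbT.
apply: (@card_fibers_le _ _ (rep : FB -> FB)) => [x _|r _]; first by rewrite inE rep_in.
have [rr|rr] := eqVneq ((r : B) * r) 0; last first.
  rewrite (_ : finset _ = set0) ?cards0 //; apply/setP => e; rewrite !inE.
  apply: contraNF rr => /andP[/eqP ee /eqP <-]; have [u [uu _ eE]] := repP e.
  have -> : rep e = u^-1 * e by rewrite [in RHS]eE mulKr.
  by rewrite -mulrA [e * (_ * _)]mulC -[_ * e * e]mulrA ee !mulr0.
have dr : (\dim (limg (amull (r : B))) <= 2)%N.
  have : (limg (amull (r : B)) <= lker (amull (r : B)))%VS.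
    by apply/subvP => _ /memv_pid[x ->]; rewrite memv_ker lfunE /= mulrA rr mul0r.
  by move/dimvS; have := dim_lker_limg r; rewrite dimB; lia.
apply: (@leq_trans #|(limg (amull (r : B)) : {vspace FB})|); last first.
  by rewrite card_vspace leq_exp2l // finNzRing_gt1.
apply: subset_leq_card; apply/subsetP => e; rewrite inE => /andP[_ /eqP <-].
by have [u [uu _ eE]] := repP e; apply/memv_pid; exists u; rewrite mulC.
Qed.

Definition quadratics : {set FB} :=
  [set y : FB | ((y : B) \notin 1%VS) && ((y : B) * y \in line y)].

Definition separable_roots (s n : k) : {set FB} :=
  [set y : FB | ((y : B) * y == n%:A + s *: (y : B)) && ((y : B) + y - s%:A \is a GRing.unit)].

(** For a fixed root x, the map y |-> (x - y) / (2 x - s) is injective with idempotent values, by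
    [quadratic_diff]. *)
Lemma card_separable_roots (s n : k) : (#|separable_roots s n| <= size R)%N.
Proof.
set A := separable_roots s n; have [->|[x xA]] := set_0Vmem A; first by rewrite cards0.
apply: leq_trans card_idempotents.
move: (xA); rewrite inE => /andP[/eqP xx uD]; set D := _ - _ in uD.
pose g (y : FB) : FB := ((x : B) - y) * D^-1.
have ginj : injective g.
  by move=> y z /(can_inj (divrK uD)) /addrI /oppr_inj.
rewrite -(card_imset _ ginj); apply: subset_leq_card; apply/subsetP => _ /imsetP[y + ->].
rewrite !inE => /andP[/eqP yy _]; rewrite /g.
have : ((x : B) - y) * (x - y) = (x - y) * D.
  by apply: (@quadratic_diff comB x y s%:A n%:A); [rewrite xx|rewrite yy]; rewrite -[RHS]/(_ + s%:A * (_ : B)) -scalerAl mul1r.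
move=> E; rewrite -mulrA [D^-1 * _]mulC !mulrA E mulrK //; exact: eqxx.
Qed.

(** Write y^2 = n + s y. Either 2 y - s is a unit, which allows at most [size R] elements y for each
    of the q^2 pairs (s, n), or y is a scalar plus an element of square zero. *)
Lemma card_quadratics : (#|quadratics| <= size R * q ^ 3 + size R * q ^ 2)%N.
Proof.
pose g (p : k * FB) : FB := p.1%:A + (p.2 : B).
pose A1 : {set FB} := g @: setX [set: k] square_zero.
pose co (y : FB) : k * k := odflt (0, 0) [pick p : k * k | (y : B) * y == p.2%:A + p.1 *: (y : B)].
pose A2 : {set FB} := [set y : FB | y \in separable_roots (co y).1 (co y).2].
have cA1 : (#|A1| <= size R * q ^ 3)%N.
  apply: leq_trans (leq_imset_card _ _) _.
  by rewrite cardsX cardsT expnS mulnCA leq_mul2l card_square_zero orbT.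
have cA2 : (#|A2| <= size R * q ^ 2)%N.
  rewrite mulnC -mulnn -card_prod -cardsT.
  apply: (@card_fibers_le _ _ co) => [y _|[s n] _]; first by rewrite inE.
  apply: leq_trans (card_separable_roots s n); apply: subset_leq_card.
  by apply/subsetP => y; rewrite inE => /andP[+ /eqP E]; rewrite inE E.
apply: leq_trans (leq_add cA1 cA2); apply: leq_trans (leq_card_setU _ _).
apply: subset_leq_card; apply/subsetP => y; rewrite inE => /andP[y1 yy].
have : (y : B) * y == (co y).2%:A + (co y).1 *: (y : B).
  rewrite /co; case: pickP => [p //|np].
  by case/memv_line1: yy => n [s yE]; have := np (s, n); rewrite /= yE eqxx.
case coE: (co y) => [s n] /= yE.
have [uD|nD] := boolP ((y : B) + y - s%:A \is a GRing.unit).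
  by rewrite !inE coE /= yE uD orbT.
have DD : ((y : B) + y - s%:A) * ((y : B) + y - s%:A) = (s * s + 4%:R * n)%:A.
  rewrite (@discriminant_sqr comB y s%:A n%:A).
    rewrite -[LHS]/((s%:A * s%:A : B) + 4%:R * n%:A) scalerDl -!scalerAl mul1r scalerA.
    by rewrite mulr_natl -scaler_nat scalerA.
  by rewrite -[RHS]/(_ + s%:A * (y : B)) -scalerAl mul1r (eqP yE).
(* The square of 2 y - s is a scalar; a nonzero one would make 2 y - s a unit. *)
have c0 : s * s + 4%:R * n = 0.
  apply: contraNeq nD => c0; apply/unitP; exists ((s * s + 4%:R * n)^-1 *: ((y : B) + y - s%:A)).
  by rewrite -scalerAr DD scalerA mulVf // scale1r.
rewrite inE; apply/orP; left; apply/imsetP.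
(* In odd characteristic, y = s / 2 + (2 y - s) / 2. *)
have [two0|two0] := eqVneq (2%:R : k) 0; last first.
  exists (2%:R^-1 * s, 2%:R^-1 *: ((y : B) + y - s%:A)); rewrite /g /= ?inE /=.
    by rewrite -scalerAl -scalerAr DD c0 scale0r !scaler0.
  rewrite -scalerA -scalerDr [X in _ *: X]addrC subrK -mulr2n -scaler_nat.
  by rewrite scalerA mulVf // scale1r.
have chB (x : B) : x + x = 0 by rewrite -[x]scale1r -scalerDl -[1 + 1]/(2%:R) two0 scale0r.
have chk (x : k) : x + x = 0 by rewrite -[x]mul1r -mulrDl -[1 + 1]/(2%:R) two0 mul0r.
have s0 : s = 0.
  by move: c0; rewrite (natrM _ 2 2) two0 !mul0r addr0 => /eqP; rewrite mulf_eq0 orbb => /eqP.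
(* In characteristic 2, s = 0 and squaring is a bijection of k, so n = m^2 and (y - m)^2 = 0. *)
have sq_inj : injective (fun x : k => x * x).
  move=> a b /= E; apply/eqP; rewrite -subr_eq0 -[_ == 0]orbb -mulf_eq0.
  have -> : (a - b) * (a - b) = a * a + b * b - (a * b + a * b) by ring.
  by rewrite E !chk subrr.
have [m nE] : exists m, n = m * m by have [h _ hK] := injF_bij sq_inj; exists (h n); rewrite hK.
exists (m, (y : B) - m%:A); rewrite /g /= ?inE /=; last by rewrite addrC subrK.
apply/eqP; rewrite mulrBl !mulrBr (eqP yE) s0 scale0r addr0 -!scalerAl -!scalerAr mul1r mulr1.
by rewrite scalerA -nE opprB addrACA -opprD !chB mulr1 oppr0 addr0 chB.
Qed.

(** * Hyperplanes *)

(* A functional that kills no nonzero principal ideal: B is a Frobenius algebra.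
   Each principal ideal rB with r in R rules out a proper subspace of functionals. *)
Lemma frobenius_functional :
  exists phi : 'Hom(B, k^o), forall b, b != 0 -> exists x, phi (b * x) != 0.
Proof.
pose T r (phi : 'Hom(B, k^o)) : 'Hom(B, k^o) := (phi \o amull r)%VF.
have Tlin r : linear (T r).
  by move=> a f g; rewrite /T comp_lfunDl comp_lfunZl.
pose TL r : {linear 'Hom(B, k^o) -> 'Hom(B, k^o)} :=
  HB.pack (T r) (GRing.isLinear.Build _ _ _ _ (T r) (Tlin r)).
pose Ws := [seq lker (linfun (TL r)) | r <- R & r != 0].
have [||phi _ phiW] := @exists_notin_subspaces _ _ {:'Hom(B, k^o)} Ws.
- by rewrite size_map (leq_ltn_trans _ Rq) // size_filter count_size.
- move=> _ /mapP[r + ->]; rewrite mem_filter => /andP[r0 _].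
  have [f fr] := functional_neq0 r0; apply: contra fr => /subvP/(_ f (memvf f)).
  rewrite memv_ker lfunE /= => /eqP/lfunP/(_ 1).
  by rewrite comp_lfunE lfunE /= mulr1 zero_lfunE => ->.
exists phi => b b0; have [u [r [uu rR bE]]] := RP b.
have r0 : r != 0 by apply: contra b0 => /eqP r0; rewrite bE r0 mulr0.
have /phiW : lker (linfun (TL r)) \in Ws.
  by apply/mapP; exists r; rewrite // mem_filter r0.
rewrite memv_ker lfunE /= => /lfunPn[x]; rewrite comp_lfunE lfunE /= zero_lfunE => rx.
by exists (u^-1 * x); rewrite bE [u * r]mulC -mulrA mulVKr.
Qed.

(** The map from b to the functional x |-> phi (b x) is injective from B to its dual, hence
    bijective by dimension. So every hyperplane is the kernel of such a functional, which is (ker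
    phi : b). *)
Lemma hyperplane_colon : exists H, forall V, \dim V = 3%N -> exists b, V = colon H b.
Proof.
have [phi phiP] := frobenius_functional.
pose F b : 'Hom(B, k^o) := (phi \o amull b)%VF.
have Flin : linear F.
  move=> a b c; apply/lfunP => x; rewrite /F add_lfunE scale_lfunE !comp_lfunE !lfunE /=.
  by rewrite mulrDl -scalerAl linearP.
pose FL : {linear B -> 'Hom(B, k^o)} := HB.pack F (GRing.isLinear.Build _ _ _ _ F Flin).
have F0 : lker (linfun FL) == 0%VS.
  rewrite -subv0; apply/subvP => b; rewrite memv_ker lfunE memv0 /=.
  apply: contraTT => /phiP[x bx]; apply/lfunPn; exists x.
  by rewrite comp_lfunE lfunE zero_lfunE.
have Fsurj : limg (linfun FL) = fullv.
  apply/eqP; rewrite eqEdim subvf limg_dim_eq ?(eqP F0) ?capv0 //.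
  by rewrite !dimvf /dim /= muln1.
exists (lker phi) => V dV.
have [v vV] : exists v, v \notin V.
  have /subvPn[v _ vV] : ~~ ({:B} <= V)%VS.
    by apply/negP => /dimvS; rewrite dimB dV.
  by exists v.
(* This map is zero on V and not at v, so following it by a functional nonzero at g v gives a
   functional with kernel V. *)
pose g := (\1 - projv V)%VF.
have gE x : g x = x - projv V x by rewrite add_lfunE opp_lfunE id_lfunE.
have gv : g v != 0.
  by rewrite gE subr_eq0; apply: contra vV => /eqP->; apply: memv_proj.
have [psi psiv] := functional_neq0 gv.
have /memv_imgP[b _ bE] : (psi \o g)%VF \in limg (linfun FL) by rewrite Fsurj memvf.
rewrite lfunE /= in bE; exists b; have CE : colon (lker phi) b = lker (psi \o g).
  by apply/vspaceP => x; rewrite memv_colon !memv_ker bE comp_lfunE lfunE.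
rewrite CE; apply/eqP; rewrite eqEdim; apply/andP; split.
  apply/subvP => x xV; rewrite memv_ker comp_lfunE gE projv_id // subrr linear0.
  exact: eqxx.
rewrite dV -ltnS -dimB ltn_neqAle dimvS ?subvf // andbT.
apply/negP => /eqP dk; have : v \in lker (psi \o g).
  rewrite (_ : lker _ = fullv) ?memvf //; apply/eqP; rewrite eqEdim subvf dk.
  exact: leqnn.
by rewrite memv_ker comp_lfunE (negPf psiv).
Qed.

(** If I = (H : u r) with u a unit, then I is in the class of (H : r). *)
Lemma card_hyperplanes : (#|[set I in classes | \dim I == 3%N]| <= size R)%N.
Proof.
have [H HP] := hyperplane_colon.
apply: leq_trans card_R.
(* The default [F0_base B] serves the r with (H : r) outside F_0; for the r attached to a hyperplane
   I of F_0, (H : r) is u I and lies in F_0. *)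
apply: leq_trans (leq_imset_card (fun r : FB => canon (insubd (F0_base B) (colon H r))) _).
apply: subset_leq_card; apply/subsetP => I; rewrite inE => /andP[/imsetP[J _ IE] /eqP dI].
have [b bE] := HP I dI; have [u [r [uu rR E]]] := RP b.
apply/imsetP; exists r; first by rewrite inE.
rewrite IE -canonK -IE; apply: canonE; apply/assoc_F0P; exists u^-1; first by rewrite unitrV.
have CE : colon I u^-1 = colon H r.
  by rewrite bE colon_colon E mulC mulKr.
rewrite -CE -[LHS]/(val _) insubdK // -topredE /=.
have [w wI uw] := F0_has_unit I.
apply: (@F0_of_unit _ (u * w)); last by rewrite unitM uu.
by rewrite memv_colon mulKr.
Qed.

Lemma card_classes_dim1 : (#|[set I in classes | \dim I == 1%N]| <= 1)%N.
Proof.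
rewrite -[X in (_ <= X)%N](cards1 (canon (F0_base B))); apply: subset_leq_card; apply/subsetP => I.
rewrite inE => /andP[/imsetP[J _ IE] /eqP dI]; rewrite inE; apply/eqP.
rewrite IE -canonK -IE; apply: canonE.
have [w wI uw] := F0_has_unit I.
apply/assoc_F0P; exists w => //; apply/eqP.
rewrite -[F0_vspace (F0_base B)]/(1%VS : {vspace B}) eqEdim dim_colon_unit // dI dimv1 leqnn andbT.
by rewrite -memvE memv_colon mulr1.
Qed.

Lemma card_classes_dim4 : (#|[set I in classes | \dim I == 4%N]| <= 1)%N.
Proof.
rewrite leqNgt; apply/negP => /card_gt1P[I [J [hI hJ /eqP[]]]]; apply/F0_eq.
have full (M : F0 B) : M \in [set I in classes | \dim I == 4%N] -> M = {:B}%VS :> {vspace B}.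
  by rewrite inE => /andP[_ /eqP dM]; apply/eqP; rewrite eqEdim subvf dM dimB.
by rewrite !full.
Qed.

(** * Counting classes *)

Lemma canon_lineP x y : x \notin 1%VS -> y \notin 1%VS ->
  (canon (lineF0 x) == canon (lineF0 y)) = assoc_F0 (lineF0 x) (lineF0 y).
Proof. by move=> x1 y1; apply/eqP/idP; [apply: eq_canon | apply: canonE]. Qed.

(** The q^4 elements y of B are scalars, or generate special planes, or give a free class <1, y>;
    each free class receives at most (q + 1) q^2 of them. *)
Lemma card_free_planes_ge :
  (q ^ 4 <= q + (size R).*2 * q ^ 2 + #|free_planes| * (q.+1 * q ^ 2))%N.
Proof.
pose G : {set FB} := [set y : FB | ((y : B) \notin 1%VS) && (y \notin special_lines)].
have cG : (#|G| <= #|free_planes| * (q.+1 * q ^ 2))%N.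
  apply: (@card_fibers_le _ _ (fun y : FB => canon (lineF0 y))) => [y|I _].
    rewrite inE => /andP[y1]; rewrite inE y1 /= => /asboolP ns.
    have ac := assoc_canon (lineF0 y); rewrite inE imset_f //=; apply/andP; split.
      by have /assoc_F0P[u uu ->] := ac; rewrite dim_colon_unit //= dim_line.
    by apply/asboolP => sc; apply: ns; apply: special_assoc (assoc_F0_sym ac) sc.
  set A := [set _ in _ | _]; have [->|[x]] := set_0Vmem A; first by rewrite cards0.
  rewrite inE => /andP[+ /eqP xI]; rewrite inE => /andP[x1 _].
  apply: leq_trans (card_fiber_le x1); apply: subset_leq_card; apply/subsetP => y.
  rewrite inE => /andP[+ /eqP yI]; rewrite !inE => /andP[y1 _]; rewrite y1 -canon_lineP //.
  by rewrite xI yI eqxx.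
have c1 : #|[set y : FB | (y : B) \in 1%VS]| = q.
  by rewrite cardsE; have := card_vspace (1%VS : {vspace FB}); rewrite (dimv1 B) expn1; apply.
rewrite -card_FB -cardsT -[X in (_ <= X + _ + _)%N]c1.
apply: leq_trans (leq_add (leq_add (leqnn _) card_special_lines) cG).
apply: leq_trans (leq_add (leq_card_setU _ _) (leqnn _)); apply: leq_trans (leq_card_setU _ _).
apply: subset_leq_card; apply/subsetP => y _; rewrite !inE.
by case: (_ \in 1%VS) => //=; case: asbool.
Qed.

Lemma class_line (I : F0 B) : \dim I = 2%N -> I \in classes ->
  exists2 x : B, x \notin 1%VS & canon (lineF0 x) = I.
Proof.
move=> dI /imsetP[J _ IJ]; have [u uI uu] := F0_has_unit I.
have dC : \dim (colon I u) = 2%N by rewrite dim_colon_unit.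
have /subvPn[x xC x1] : ~~ (colon I u <= 1)%VS.
  by apply/negP => /dimvS; rewrite dC dimv1.
have IE : canon I = I by rewrite IJ canonK.
exists x => //; rewrite -[RHS]IE; apply/esym/canonE/assoc_F0P; exists u => //=.
by apply: line_eq => //; rewrite memv_colon mulr1.
Qed.

(** Here m and n count the classes of planes <1, x> that are not, respectively are, subalgebras.
    Summing their fibers bounds m through the q^4 elements of B and n through the quadratics.
    Hyperplanes give at most [size R] classes, dimensions 1 and 4 at most one each. *)
Lemma card_classes_le_sum : exists m n : nat,
  [/\ (#|classes| <= m + n + size R + 2)%N,
      (m * ((q - size R) * (q * q.-1)) <= q ^ 4)%N
    & (n * (q * q.-1) <= size R * q ^ 3 + size R * q ^ 2)%N].
Proof.
pose f (y : FB) := canon (lineF0 y).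
pose P (I : F0 B) := [pred x : FB | ((x : B) \notin 1%VS) && (f x == I)].
pose M := [set I : F0 B | [exists x, P I x && ((x : B) * x \notin line x)]].
pose N := [set I : F0 B | [exists x, P I x && ((x : B) * x \in line x)]].
exists #|M|, #|N|; split.
- pose C d := [set I in classes | \dim I == d].
  have C2 : (#|C 2%N| <= #|M| + #|N|)%N.
    apply: leq_trans (leq_card_setU _ _); apply: subset_leq_card; apply/subsetP => I.
    rewrite inE => /andP[cI /eqP dI]; have [x x1 xI] := class_line dI cI.
    rewrite !inE; have [xx|xx] := boolP (x * x \in line x); apply/orP; [right|left];
      by apply/existsP; exists x; rewrite /= x1 xx /f xI eqxx.
  apply: (@leq_trans (#|C 2%N| + #|C 3%N| + (#|C 1%N| + #|C 4%N|))%N); last first.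
    by rewrite !leq_add ?card_hyperplanes // (leq_add card_classes_dim1 card_classes_dim4).
  apply: leq_trans (leq_add (leq_card_setU _ _) (leq_card_setU _ _)).
  apply: leq_trans (leq_card_setU _ _); apply: subset_leq_card; apply/subsetP => I cI.
  rewrite !inE cI /=; have := dimvS (subvf I); rewrite dimB.
  have : (0 < \dim I)%N.
    rewrite lt0n dimv_eq0; apply/eqP => I0; have [u] := F0_has_unit I.
    by rewrite I0 memv0 => /eqP->; rewrite unitr0.
  by case: (\dim I) => [|[|[|[|[|]]]]].
- rewrite -card_FB -[X in (_ <= X)%N]cardsT; apply: (@card_fibers_ge _ _ f) => I.
  rewrite inE => /existsP[x /andP[/andP[x1 /eqP xI] xx]].
  apply: leq_trans (card_fiber_ge x1 xx) _; apply: subset_leq_card; apply/subsetP => y.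
  by rewrite !inE /= => /andP[y1]; rewrite -canon_lineP // -xI eq_sym.
- apply: leq_trans card_quadratics; apply: (@card_fibers_ge _ _ f) => I.
  rewrite inE => /existsP[x /andP[/andP[x1 /eqP xI] xx]].
  apply: leq_trans (card_line_le x1) _; apply: subset_leq_card; apply/subsetP => y.
  rewrite !inE /= => /andP[y1 yx]; rewrite y1 -xI eq_sym canon_lineP //.
  have E : line y = line x by apply: line_eq; rewrite ?dim_line ?line_1.
  rewrite E line_mul //=; apply/assoc_F0P; exists 1; rewrite ?unitr1 //= colon1.
  exact: E.
Qed.

Hypothesis q_large : (4 * size R + 4 <= q)%N.

Lemma card_free_planes_quarter : (q <= 4 * #|free_planes|)%N.
Proof. exact: free_planes_arith q_large card_free_planes_ge. Qed.

Lemma card_classes_le : (#|classes| <= (2 * size R + 6) * q)%N.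
Proof.
have [m [n [h hm hn]]] := card_classes_le_sum; apply: leq_trans h _.
apply: classes_arith => //; first exact: nonalgebra_arith hm.
exact: algebra_arith hn.
Qed.

Theorem card_Star_bounds :
  (2 ^ #|free_planes| <= #|Star B| <= 2 ^ ((2 * size R + 6) * q))%N
    /\ (q <= 4 * #|free_planes|)%N.
Proof.
split; last exact: card_free_planes_quarter.
rewrite card_Star_ge; apply: leq_trans card_Star_le _.
by rewrite leq_exp2l // card_classes_le.
Qed.

End Structure.

(** * The algebras B_s *)

(** A nonzero p is X^a g with g(0) nonzero; then g is coprime to X^f, hence a unit. *)
Lemma trunc_poly_assoc (k : fieldType) (L : fieldExtType k) (f : nat) (f_gt0 : (0 < f)%N)
    (p : trunc_poly L f) :
  exists (u v : trunc_poly L f) (a : 'I_f.+1),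
    u * v = 1 /\ p = u * in_qpoly ('X^f : {poly L}) 'X^a.
Proof.
have mkE : mk_monic ('X^f : {poly L}) = 'X^f by rewrite mk_monic_Xn prednK.
have small (g : {poly L}) : (size g <= f)%N -> in_qpoly 'X^f g = g :> {poly L}.
  by move=> sg; apply: in_qpoly_small; rewrite mkE size_polyXn.
have [p0|p0] := eqVneq (p : {poly L}) 0.
  (* Zero is X^f, so the exponent f has to be allowed. *)
  exists 1, 1, ord_max; split; rewrite ?mulr1 // mul1r; apply: val_inj => /=.
  by rewrite p0 mkE Pdiv.CommonRing.rmodpp //; apply: mulrC.
have sp : (size (p : {poly L}) <= f)%N.
  have fE : f.+1 = size (mk_monic ('X^f : {poly L})) by rewrite mkE size_polyXn.
  by rewrite -ltnS fE; apply: size_mk_monic.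
have [a [g]] := multiplicity_XsubC (p : {poly L}) 0; rewrite p0 /= subr0 => g0 pE.
have gn0 : g != 0 by apply: contra g0 => /eqP->; apply: root0.
have sE : size (p : {poly L}) = (a + size g)%N by rewrite pE size_mulXn.
have af : (a < f.+1)%N by rewrite ltnS; apply: leq_trans sp; rewrite sE leq_addr.
have sg : (size g <= f)%N by apply: leq_trans sp; rewrite sE leq_addl.
have cop : coprimep (mk_monic ('X^f : {poly L})) (in_qpoly 'X^f g).
  by rewrite small // mkE coprimep_expl // coprimep_sym coprimepX.
exists (in_qpoly 'X^f g), (qpoly_inv (in_qpoly 'X^f g)), (Ordinal af); split.
  exact: qpoly_mulzV.
apply: val_inj; rewrite -[RHS]/(val (in_qpoly _ g * in_qpoly _ 'X^a)) -in_qpolyM -pE.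
by rewrite -[RHS]/(in_qpoly _ _ : {poly L}) small.
Qed.

Definition Bs_monomial (t : nat) (s : t.+1.-tuple (nat * nat)) (q m : nat)
    (a : {ffun 'I_t.+1 -> 'I_m}) : Bs s q :=
  [ffun i : 'I_t.+1 => in_qpoly 'X^((tnth s i).2) 'X^(a i)
     : trunc_poly (GFext (GF q) (tnth s i).1) (tnth s i).2].

Lemma Bs_assoc (t : nat) (s : t.+1.-tuple (nat * nat)) (q m : nat) (x : Bs s q) :
  (forall i, 0 < (tnth s i).2 < m)%N ->
  exists u (a : {ffun 'I_t.+1 -> 'I_m}), u \is a GRing.unit /\ x = u * Bs_monomial s q a.
Proof.
move=> s_m.
pose A (i : 'I_t.+1) : falgType (GF q) := trunc_poly (GFext (GF q) (tnth s i).1) (tnth s i).2.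
have H i : exists w : A i * A i * 'I_m,
    w.1.1 * w.1.2 = 1 /\ x i = w.1.1 * (in_qpoly 'X^((tnth s i).2) 'X^(w.2) : A i).
  have /andP[f0 fm] := s_m i; have [u [v [a [uv xE]]]] := trunc_poly_assoc f0 (x i).
  by exists (u, v, widen_ord fm a).
have {H}[w H] := fin_all_exists H.
exists ([ffun i : 'I_t.+1 => (w i).1.1 : A i] : Bs s q), [ffun i => (w i).2]; split.
  apply: (introT (unitP (@Bs_mulC t s q) _)).
  exists ([ffun i : 'I_t.+1 => (w i).1.2 : A i] : Bs s q).
  by apply/ffunP => i; rewrite !ffunE; case: (H i).
by apply/ffunP => i; rewrite !ffunE; case: (H i).
Qed.

Lemma card_GF (q : nat) : prime_power q -> #|GF q| = q.
Proof. exact: svalP (GF_exists q). Qed.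

Lemma tnth_le_n_of (t : nat) (s : t.+1.-tuple (nat * nat)) i :
  (0 < (tnth s i).1)%N -> ((tnth s i).2 <= n_of s)%N.
Proof.
move=> e0; rewrite /n_of (bigD1 i) //=; apply: leq_trans (leq_addr _ _).
by rewrite leq_pmull.
Qed.

Lemma Lambda_bounds (t : nat) (s : t.+1.-tuple (nat * nat)) :
  (forall i : 'I_t.+1, (0 < (tnth s i).1)%N /\ (0 < (tnth s i).2)%N) ->
  n_of s = 4%N ->
  exists N, forall q, prime_power q -> (N <= q)%N ->
  exists2 m, (q <= 4 * m)%N & (2 ^ m <= Lambda s q <= 2 ^ (N * q))%N.
Proof.
(* Exponents up to 4 suffice, as each f_i is at most n(s) = 4. *)
move=> s_gt0 n_s; pose M := #|{: {ffun 'I_t.+1 -> 'I_5}}|.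
(* This is at least the threshold 4 M + 4 on q and the factor 2 M + 6 of the upper bound. *)
exists (4 * M + 6)%N => q qpp qN; have cq := card_GF qpp.
pose R := codom (@Bs_monomial t s q 5).
have sR : size R = M by rewrite size_codom.
have RP (x : Bs s q) : exists u r, [/\ u \is a GRing.unit, r \in R & x = u * r].
  have [|u [a [uu xE]]] := @Bs_assoc t s q 5 x.
    move=> i; have [e0 ->] := s_gt0 i; rewrite ltnS -n_s; exact: tnth_le_n_of.
  by exists u, (Bs_monomial s q a); split=> //; apply: codom_f.
have dB : \dim {:Bs s q} = 4%N by rewrite dim_Bs.
have Rq : (size R < #|GF q|)%N by rewrite sR cq; lia.
have Rq4 : (4 * size R + 4 <= #|GF q|)%N by rewrite sR cq; lia.
have [/andP[lo hi] qm] := card_Star_bounds (@Bs_mulC t s q) dB RP Rq Rq4.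
exists #|free_planes (Bs s q)|; first by move: qm; rewrite cq.
rewrite /Lambda lo; apply: leq_trans hi _; rewrite leq_exp2l // sR cq leq_mul2r.
by apply/orP; right; lia.
Qed.

(* Passage to the limit *)
From mathcomp Require Import mathcomp_extra classical_sets functions.
From mathcomp Require Import reals topology normedtype sequences exp.
Import numFieldNormedType.Exports.

Local Open Scope classical_set_scope.

Lemma logb2_bounds (R : realType) (m n L : nat) :
  (2 ^ m <= L <= 2 ^ n)%N -> m%:R <= logb (2 : R) L%:R <= n%:R.
Proof.
move=> /andP[lo hi]; have ln2 : 0 < ln 2 :> R by rewrite ln_gt0 // ltr1n.
have L0 : (0 < L)%N by rewrite (leq_trans _ lo) // expn_gt0.
rewrite /logb ler_pdivlMr // ler_pdivrMr // !mulr_natl -!lnXn // -!natrX.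
by rewrite !ler_ln ?posrE ?ltr0n ?expn_gt0 ?L0 // !ler_nat lo.
Qed.

(** For l = log_2 Lambda, the bounds q / 4 <= l <= N q keep ln l - ln q bounded, and theta - 1 is
    this difference divided by ln q. *)
Theorem theorem7p6 (R : realType) (t : nat) (s : t.+1.-tuple (nat * nat))
    (s_gt0 : forall i : 'I_t.+1, (0 < (tnth s i).1)%N /\ (0 < (tnth s i).2)%N)
    (n_s : n_of s = 4%N) :
  theta R s q @[q --> within prime_power \oo] --> (1 : R).
Proof.
have [N HN] := Lambda_bounds s_gt0 n_s.
apply/cvgrPdist_le => e e0; rewrite near_withinE.
(* This bounds |ln l - ln q|; the successor of N keeps the argument of the logarithm positive. *)
pose c : R := ln 4 + ln N.+1%:R.
near=> q => qpp.
have [|m qm LE] := HN q qpp; first by near: q; exact: nbhs_infty_ge.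
have /andP[lo hi] := logb2_bounds R LE.
have q1 : (1 : R) < q%:R by near: q; exact: nbhs_infty_gtr.
have qc : expR (c / e) < q%:R :> R by near: q; exact: nbhs_infty_gtr.
have q0 : (0 : R) < q%:R by apply: lt_trans q1.
have lnq : 0 < ln (q%:R : R) by rewrite ln_gt0.
have ce : c <= e * ln q%:R.
  rewrite mulrC -ler_pdivrMr // -[leLHS]expRK ler_ln ?posrE ?expR_gt0 //.
  exact: ltW.
have q4 : q%:R / 4 <= m%:R :> R by rewrite ler_pdivrMr // mulrC -natrM ler_nat.
rewrite /theta; move: (logb (2 : R) _) lo hi => l lo hi.
have l4 : q%:R / 4 <= l by apply: le_trans lo.
have l0 : 0 < l by apply: lt_le_trans l4; rewrite divr_gt0.
have lo' : ln q%:R - ln 4 <= ln l.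
  by rewrite -ln_div ?posrE // ler_ln ?posrE // divr_gt0.
have hi' : ln l <= ln N.+1%:R + ln q%:R.
  rewrite -lnM ?posrE ?ltr0Sn // ler_ln ?posrE ?mulr_gt0 ?ltr0Sn //.
  by apply: le_trans hi _; rewrite natrM ler_pM2r // ler_nat.
have h4 : 0 <= ln 4 :> R by rewrite ln_ge0 // ler1n.
have hN : 0 <= ln N.+1%:R :> R by rewrite ln_ge0 // ler1n.
rewrite /logb -[X in `|X - _|](divff (lt0r_neq0 lnq)) -mulrBl normrM.
rewrite [`|_^-1|]gtr0_norm ?invr_gt0 // ler_pdivrMr //.
apply: le_trans ce; rewrite ler_norml /c; lra.
Unshelve. all: by end_near.
Qed.
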